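(* Let $d\in\mathbb{N}$. In the fixed design regression setting on the simplex described in the context, suppose that Assumptions (A1)--(A4) listed in the context hold, and let $\mathcal{J}\subseteq[d]$ and $\boldsymbol{\lambda}=(\lambda_1,\dots,\lambda_d)\in(2,\infty)^d$ be given. If a sequence $\boldsymbol{s}=\boldsymbol{s}(b)$ is selected inside $\mathrm{Int}(\mathcal{S}_d)$ such that $s_j/b\to\lambda_j$ for every $j\in\mathcal{J}$, and $s_j$ is fixed (does not depend on $b$) for every $j\in[d]\setminus\mathcal{J}$, then, as $n\to\infty$, $$\mathsf{Var}\{\hat m_{n,b}^{\mathrm{GM}}(\boldsymbol{s})\}=n^{-1}b^{-(d+|\mathcal{J}|)/2}\left\{\frac{\psi_{\mathcal{J}}(\boldsymbol{s})\,\sigma^2(\boldsymbol{s})}{f(\boldsymbol{s})}\prod_{j\in\mathcal{J}}\frac{\Gamma(2\lambda_j+1)}{2^{2\lambda_j+1}\Gamma^2(\lambda_j+1)}+\mathrm{o}_{\boldsymbol{\lambda},\boldsymbol{s}}(1)\right\},$$ where, for every $\mathcal{J}\subseteq[d]$ and $\boldsymbol{s}\in\mathrm{Int}(\mathcal{S}_d)$, $$\psi_{\mathcal{J}}(\boldsymbol{s})=\left\{(4\pi)^{d-|\mathcal{J}|}(1-\|\boldsymbol{s}\|_1)\prod_{j\in[d]\setminus\mathcal{J}}s_j\right\}^{-1/2}.$$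
   Context: Notation. $\mathcal{S}_d=\{\boldsymbol{s}\in[0,1]^d:\|\boldsymbol{s}\|_1\le 1\}$, $\mathrm{Int}(\mathcal{S}_d)=\{\boldsymbol{s}\in(0,1)^d:\|\boldsymbol{s}\|_1<1\}$, with $\|\cdot\|_1$ the $\ell^1$ norm; $[n]=\{1,\dots,n\}$, $[d]=\{1,\dots,d\}$; $\mathrm{Leb}$ is Lebesgue measure on $\mathbb{R}^d$. Subscripts on $\mathrm{o}$ indicate the quantities on which the rate of convergence may depend. For $\boldsymbol{\alpha}\in(0,\infty)^d$, $\beta\in(0,\infty)$, the $\mathrm{Dirichlet}(\boldsymbol{\alpha},\beta)$ density on $\mathcal{S}_d$ is $$K_{\boldsymbol{\alpha},\beta}(\boldsymbol{s})=\frac{\Gamma(\|\boldsymbol{\alpha}\|_1+\beta)}{\Gamma(\beta)\prod_{j=1}^d\Gamma(\alpha_j)}(1-\|\boldsymbol{s}\|_1)^{\beta-1}\prod_{j=1}^d s_j^{\alpha_j-1}.$$ For $\boldsymbol{s}\in\mathcal{S}_d$ and $b\in(0,\infty)$ put $\kappa_{\boldsymbol{s},b}=K_{\boldsymbol{s}/b+\boldsymbol{1},\,(1-\|\boldsymbol{s}\|_1)/b+1}$, with $\boldsymbol{1}=(1,\dots,1)$. Setting. For each $n$ there are deterministic design points $\boldsymbol{x}_1,\dots,\boldsymbol{x}_n\in\mathrm{Int}(\mathcal{S}_d)$ (depending on $n$; the dependence is suppressed), with design density $f$, a probability density on $\mathcal{S}_d$: for every Borel set $B\subseteq\mathbb{R}^d$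 with $\mathrm{Leb}(\partial B)=0$, $\lim_{n\to\infty}\frac1n\sum_{i=1}^n\mathbf{1}_B(\boldsymbol{x}_i)=\int_B f(\boldsymbol{x})\,d\boldsymbol{x}$. The responses are $Y_i=m(\boldsymbol{x}_i)+\varepsilon_i$, $i\in[n]$, where $m:\mathcal{S}_d\to\mathbb{R}$ and, for each $n$, the errors $\varepsilon_1,\dots,\varepsilon_n$ are mutually independent with $\varepsilon_i$ of mean zero and variance $\sigma^2(\boldsymbol{x}_i)$. Given a smoothing parameter $b=b(n)\in(0,\infty)$ and sets $B_1,\dots,B_n$ (depending on $n$) as in (A4) below, the Dirichlet-kernel Gasser--Müller estimator is $$\hat m_{n,b}^{\mathrm{GM}}(\boldsymbol{s})=\sum_{i=1}^n Y_i\int_{B_i}\kappa_{\boldsymbol{s},b}(\boldsymbol{x})\,d\boldsymbol{x},\qquad\boldsymbol{s}\in\mathcal{S}_d.$$ Assumptions. (A1) $f$ and $\sigma^2$ are Lipschitz continuous on $\mathcal{S}_d$, and $m$ is twice continuously differentiable on $\mathcal{S}_d$ (in particular $\sigma^2$ is bounded on $\mathcal{S}_d$). (A2) $\min_{\mathcal{S}_d}f>0$ and $\min_{\mathcal{S}_d}\sigma^2>0$. (A3) $b=b(n)\to0$ and $n^{-1/d}=\mathrm{o}(b)$ as $n\to\infty$. (A4) For every $n\in\mathbb{N}$, $B_1,\dots,B_n$ are convex compact subsets of $\mathcal{S}_d$ such that: (a) $\mathrm{Int}(B_i)\cap\mathrm{Int}(B_j)=\emptyset$ for $i\ne j$ and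 $B_1\cup\dots\cup B_n=\mathcal{S}_d$; (b) $\boldsymbol{x}_i\in\mathrm{Int}(B_i)$ for every $i\in[n]$; (c) $\mathrm{Leb}(\partial B_i)=0$ for every $i\in[n]$; (d) $\mathrm{diam}(B_i)=\mathcal{O}(n^{-1/d})$ uniformly in $i$ as $n\to\infty$; (e) $|\int_{B_i}f(\boldsymbol{t})\,d\boldsymbol{t}-n^{-1}|=\mathcal{O}(n^{-1-1/d})$ uniformly in $i$ as $n\to\infty$. *)

(* Defs.v *)
From HB Require Import structures.
From mathcomp Require Import all_boot all_order all_algebra.
From mathcomp Require Import all_classical all_reals all_analysis.
From mathcomp Require Import measurable_realfun.

Set Implicit Arguments.
Unset Strict Implicit.
Unset Printing Implicit Defensive.

Import Order.TTheory GRing.Theory Num.Theory.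
Import numFieldNormedType.Exports.

Local Open Scope classical_set_scope.
Local Open Scope ring_scope.

(* Row vectors carry the Borel sigma-algebra of their (product) topology. *)
HB.instance Definition _ (R : realType) (d : nat) :=
  @isMeasurable.Build (sigma_display (@open 'rV[R]_d)) 'rV[R]_d
    <<s @open 'rV[R]_d >> (@sigma_algebra0 _ setT _) (@sigma_algebraC _ _)
    (@sigma_algebra_bigcup _ setT _).

Section BorelRowVectors.
Context {R : realType}.

Lemma open_measurable_rV (d : nat) (U : set 'rV[R]_d) :
  open U -> measurable U.
Proof. exact: sub_sigma_algebra. Qed.

Lemma measurable_rV_coord (d : nat) (i : 'I_d) :
  measurable_fun [set: 'rV[R]_d] (fun v : 'rV[R]_d => v 0 i).
Proof.
refine (@measurability _ _ _ _ _ _ (@RGenOpens.G R) (RGenOpens.measurableE R) _).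
move=> _ [_ [a [b ->]] <-]; rewrite setTI; apply: open_measurable_rV.
apply: open_comp; last exact: interval_open.
by move=> v _; exact: coord_continuous.
Qed.

(* R^d is second countable, so measurability into it is coordinatewise. *)
Lemma measurable_fun_rV (disp : measure_display) (T : measurableType disp)
    (d : nat) (g : T -> 'rV[R]_d) :
  (forall i, measurable_fun setT (fun x => g x 0 i)) -> measurable_fun setT g.
Proof.
move=> mg; apply: (measurability (@open 'rV[R]_d)) => //.
move=> A [U oU <-{A}]; rewrite setTI.
pose c (p : 'rV[rat]_d) : 'rV[R]_d := map_mx ratr p.
pose F (p : 'rV[rat]_d * nat) : set T :=
  if pselect (ball (c p.1) p.2.+1%:R^-1 `<=` U)
  then g @^-1` (ball (c p.1) p.2.+1%:R^-1) else set0.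
have -> : g @^-1` U = \bigcup_p F p.
  apply/seteqP; split => [x /= Ux|x [p _]]; last first.
    by rewrite /F; case: pselect => // pU; exact: pU.
  have /nbhs_ballP[e /= e0 eU] : nbhs (g x) U by exact: open_nbhs_nbhs.
  have [k ke] : exists k, k.+1%:R^-1 < e / 2 :> R.
    have e20 : 0 < (e / 2)^-1 by rewrite invr_gt0 divr_gt0.
    exists (Num.truncn (e / 2)^-1).
    by rewrite invf_plt ?posrE ?divr_gt0// truncnS_gt.
  have q_ i : exists q : rat,
      ratr q \in `]g x 0 i - k.+1%:R^-1, g x 0 i + k.+1%:R^-1[.
    apply/rat_in_itvoo.
    by rewrite ltrBlDr -addrA ltrDl addr_gt0.
  pose p : 'rV[rat]_d := \row_i projT1 (cid (q_ i)).
  have px : ball (c p) k.+1%:R^-1 (g x).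
    split; first by rewrite invr_gt0.
    move=> i j; rewrite ord1 !mxE /ball/=.
    case: cid => q /=; rewrite in_itv/= => /andP[q1 q2].
    by rewrite distrC ltr_distlC q1.
  exists (p, k) => //; rewrite /F/=; case: pselect => // -[] y py; apply: eU.
  have: ball (g x) (k.+1%:R^-1 + k.+1%:R^-1) y.
    by apply: ball_triangle py; exact: ball_sym.
  apply: le_ball; rewrite (splitr e).
  by apply: lerD; exact: ltW.
apply: countable_bigcupT_measurable => // -[p k].
rewrite /F; case: pselect => /= [_|_ //].
have -> : g @^-1` ball (c p) k.+1%:R^-1 =
    \bigcap_(i in [set: 'I_d]) ((fun x => g x 0 i) @^-1` ball (c p 0 i) k.+1%:R^-1).
  apply/seteqP; split => x xp.
    by move=> i _; exact: xp.2.
  by split=> [|i j]; [rewrite invr_gt0|rewrite ord1; exact: xp].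
apply: fin_bigcap_measurable => // i _.
rewrite -[X in measurable X]setTI; apply: mg => //.
by apply: open_measurable; exact: ball_open.
Qed.

Definition row_cons (d : nat) (p : measurableTypeR R * 'rV[R]_d) : 'rV[R]_d.+1 :=
  row_mx p.1%:M p.2.

Definition row_uncons (d : nat) (v : 'rV[R]_d.+1) :
    measurableTypeR R * 'rV[R]_d :=
  (v 0 0, rsubmx (v : 'rV_(1 + d))).

Lemma row_cons0 (d : nat) (p : measurableTypeR R * 'rV[R]_d) :
  row_cons p 0 0 = p.1.
Proof.
transitivity ((row_mx p.1%:M p.2 : 'rV[R]_(1 + d)) 0 (lshift d 0)).
  by congr (fun_of_matrix _ _ _); exact/val_inj.
by rewrite row_mxEl mxE eqxx.
Qed.

Lemma row_consS (d : nat) (p : measurableTypeR R * 'rV[R]_d) (j : 'I_d) :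
  row_cons p 0 (lift ord0 j) = p.2 0 j.
Proof.
transitivity ((row_mx p.1%:M p.2 : 'rV[R]_(1 + d)) 0 (rshift 1 j)).
  by congr (fun_of_matrix _ _ _); exact/val_inj.
by rewrite row_mxEr.
Qed.

Lemma row_consK (d : nat) : cancel (@row_cons d) (@row_uncons d).
Proof.
move=> [x v]; rewrite /row_uncons row_cons0/=; congr pair.
by rewrite /row_cons row_mxKr.
Qed.

Lemma measurable_row_cons (d : nat) : measurable_fun setT (@row_cons d).
Proof.
apply: measurable_fun_rV => i; case: (fintype.unliftP ord0 i) => [j|] ->.
  rewrite (_ : (fun x => _) = (fun v : 'rV[R]_d => v 0 j) \o snd).
    exact: measurableT_comp (measurable_rV_coord j) measurable_snd.
  by apply/funext => x; rewrite row_consS.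
rewrite (_ : (fun x => _) = fst); first exact: measurable_fst.
by apply/funext => x; rewrite row_cons0.
Qed.

Lemma measurable_row_uncons (d : nat) : measurable_fun setT (@row_uncons d).
Proof.
apply: measurable_fun_pair; first exact: measurable_rV_coord.
apply: measurable_fun_rV => i.
rewrite (_ : (fun x => _) = fun v : 'rV[R]_d.+1 => v 0 (rshift 1 i)).
  exact: measurable_rV_coord.
by apply/funext => v; rewrite mxE.
Qed.

End BorelRowVectors.

Section LebesgueRowVectors.
Context {R : realType}.
Local Open Scope ereal_scope.

Definition lebesgue_cons (d : nat)
    (mu : {sigma_finite_measure set 'rV[R]_d -> \bar R}) :
    set 'rV[R]_d.+1 -> \bar R :=
  pushforward (@lebesgue_measure R \x mu) (@row_cons R d).

Section lebesgue_cons_measure.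
Variables (d : nat) (mu : {sigma_finite_measure set 'rV[R]_d -> \bar R}).

Let cons0 : lebesgue_cons mu set0 = 0.
Proof. by rewrite /lebesgue_cons /pushforward preimage_set0 measure0. Qed.

Let cons_ge0 A : 0 <= lebesgue_cons mu A.
Proof. by rewrite /lebesgue_cons /pushforward measure_ge0. Qed.

Let cons_sigma_additive : semi_sigma_additive (lebesgue_cons mu).
Proof.
move=> F mF tF mUF; rewrite /lebesgue_cons /pushforward preimage_bigcup.
apply: measure_semi_sigma_additive.
- by move=> n; rewrite -[X in measurable X]setTI; exact: measurable_row_cons.
- apply/trivIsetP => /= i j _ _ ij; rewrite -preimage_setI.
  by move/trivIsetP : tF => /(_ _ _ _ _ ij) ->//; rewrite preimage_set0.
- by rewrite -preimage_bigcup -[X in measurable X]setTI;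
    exact: measurable_row_cons.
Qed.

HB.instance Definition _ := isMeasure.Build _ _ _ (lebesgue_cons mu)
  cons0 cons_ge0 cons_sigma_additive.

Let cons_sigma_finite : sigma_finite setT (lebesgue_cons mu).
Proof.
have /sigma_finiteP[F [TF ndF Foo]] := sigma_finiteT (@lebesgue_measure R).
have /sigma_finiteP[G [TG ndG Goo]] := sigma_finiteT mu.
exists (fun k => @row_uncons R d @^-1` (F k `*` G k)).
  apply/esym; rewrite -subTset => v _.
  have [i _ Fi] : (\bigcup_i F i) (row_uncons v).1 by rewrite -TF.
  have [j _ Gj] : (\bigcup_j G j) (row_uncons v).2 by rewrite -TG.
  exists (maxn i j) => //; split.
  - by move: Fi; exact/subsetPset/ndF/leq_maxl.
  - by move: Gj; exact/subsetPset/ndG/leq_maxr.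
move=> k; have [mF Fk] := Foo k; have [mG Gk] := Goo k; split.
  rewrite -[X in measurable X]setTI; apply: measurable_row_uncons => //.
  exact: measurableX.
rewrite /lebesgue_cons /pushforward -comp_preimage.
rewrite (_ : _ \o _ = id) ?preimage_id; last by apply/funext; exact: row_consK.
by rewrite product_measure1E// lte_mul_pinfty// ge0_fin_numE.
Qed.

HB.instance Definition _ := Measure_isSigmaFinite.Build _ _ _
  (lebesgue_cons mu) cons_sigma_finite.

End lebesgue_cons_measure.

Fixpoint lebesgue_rV (d : nat) : {sigma_finite_measure set 'rV[R]_d -> \bar R} :=
  if d is d'.+1 then lebesgue_cons (lebesgue_rV d') else \d_(0%R : 'rV[R]_0).

(* Lebesgue measure is normalised by the volume of boxes. *)
Lemma lebesgue_rV_box (d : nat) (A : 'I_d -> set R) :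
  (forall i, measurable (A i)) ->
  lebesgue_rV d [set v | forall i, A i (v ord0 i)]
    = \prod_(i < d) lebesgue_measure (A i).
Proof.
elim: d A => [|d IH] A mA.
  rewrite big_ord0 /= diracE mem_set// => -[]//.
pose C := [set v : 'rV[R]_d | forall i, A (lift ord0 i) (v ord0 i)].
have mC : measurable C.
  rewrite (_ : C = \bigcap_(i in [set: 'I_d])
    ((fun v : 'rV[R]_d => v ord0 i) @^-1` A (lift ord0 i))).
    apply: fin_bigcap_measurable => // i _.
    rewrite -[X in measurable X]setTI.
    exact: (measurable_rV_coord i measurableT (mA _)).
  by apply/seteqP; split=> [v vA i _|v vA i]; [exact: vA|exact: (vA i)].
rewrite big_ord_recl -IH// -product_measure1E//.
rewrite /= /lebesgue_cons /pushforward; congr (_ _).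
apply/seteqP; split=> -[x v]/= => [xvA|[Ax Cv] i].
  split=> [|i].
    by have := xvA ord0; rewrite (row_cons0 (x, v)).
  by have := xvA (lift ord0 i); rewrite (row_consS (x, v)).
case: (fintype.unliftP ord0 i) => [j|] ->.
  by rewrite (row_consS (x, v)); exact: Cv.
by rewrite (row_cons0 (x, v)).
exact: mA.
Qed.

End LebesgueRowVectors.

Section Simplex.
Context {R : realType} {d : nat}.
Implicit Types (s x : 'rV[R]_d) (A : set 'rV[R]_d).

Definition l1norm s : R := \sum_(j < d) `|s 0 j|.

Definition l2norm s : R := Num.sqrt (\sum_(j < d) s 0 j ^+ 2).

Definition simplex : set 'rV[R]_d :=
  [set s : 'rV[R]_d | (forall j, 0 <= s 0 j <= 1) /\ l1norm s <= 1].

Definition simplex_int : set 'rV[R]_d :=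
  [set s : 'rV[R]_d | (forall j, 0 < s 0 j < 1) /\ l1norm s < 1].

Definition boundary A : set 'rV[R]_d := closure A `\` A°.

Definition diam A : R := sup [set l2norm (p.1 - p.2) | p in A `*` A].

Definition is_min_on A (g : 'rV[R]_d -> R) (c : R) : Prop :=
  (exists2 x, A x & g x = c) /\ (forall x, A x -> c <= g x).

(* Functions on the simplex are represented by total functions on R^d of which
   only the values on the simplex are constrained. *)

Definition simplex_density (f : 'rV[R]_d -> R) : Prop :=
  [/\ measurable_fun simplex f, forall x, simplex x -> 0 <= f x
    & (\int[lebesgue_rV d]_(x in simplex) (f x)%:E = 1)%E].

(* Twice continuously differentiable on the closed simplex: G and H are the
   first and second order partial derivatives in the interior, and g, G and H
   are continuous up to the boundary. *)
Definition simplex_C2 (g : 'rV[R]_d -> R) : Prop :=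
  exists (G : 'I_d -> 'rV[R]_d -> R) (H : 'I_d -> 'I_d -> 'rV[R]_d -> R),
  [/\ {within simplex, continuous g},
      forall i, {within simplex, continuous (G i)},
      forall i j, {within simplex, continuous (H i j)},
      forall x i, simplex_int x -> is_derive x (delta_mx 0 i) g (G i x)
    & forall x i j, simplex_int x ->
        is_derive x (delta_mx 0 j) (G i) (H i j x)].

End Simplex.
Arguments simplex : clear implicits.
Arguments simplex_int : clear implicits.

Section Dirichlet.
Context {R : realType} {d : nat}.
Implicit Types (s x alpha : 'rV[R]_d) (b beta : R).

Definition Gamma (a : R) : R :=
  \int[lebesgue_measure]_(t in `]0, +oo[) (t `^ (a - 1) * expR (- t)).

Definition dirichlet_density alpha beta s : R :=
  Gamma (l1norm alpha + beta) / (Gamma beta * \prod_(j < d) Gamma (alpha 0 j))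
  * (1 - l1norm s) `^ (beta - 1) * \prod_(j < d) s 0 j `^ (alpha 0 j - 1).

Definition dirichlet_kernel s b : 'rV[R]_d -> R :=
  dirichlet_density (b^-1 *: s + const_mx 1) ((1 - l1norm s) / b + 1).

Definition gm_estimator (n : nat) b (B : 'I_n -> set 'rV[R]_d) (Y : 'I_n -> R)
    s : R :=
  \sum_(i < n) Y i * \int[lebesgue_rV d]_(x in B i) dirichlet_kernel s b x.

Definition psi (J : {set 'I_d}) s : R :=
  ((4 * pi) ^+ (d - #|J|) * (1 - l1norm s) * \prod_(j in ~: J) s 0 j)
    `^ (- 2^-1).

End Dirichlet.

Section Design.
Context {R : realType} {d : nat}.
Variables (f : 'rV[R]_d -> R) (x : forall n : nat, 'I_n -> 'rV[R]_d).

(* f is a density on the simplex, hence the intersection with simplex R d. *)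
Definition design_density : Prop :=
  simplex_density f /\
  forall A : set 'rV[R]_d, measurable A -> lebesgue_rV d (boundary A) = 0%E ->
    n%:R^-1 * \sum_(i < n) \1_A (x i) @[n --> \oo] -->
      \int[lebesgue_rV d]_(t in A `&` simplex R d) f t.

Variable B : forall n : nat, 'I_n -> set 'rV[R]_d.

Record gm_partition : Prop := {
  gm_convex : forall n (i : 'I_n), convex_set (B i);
  gm_compact : forall n (i : 'I_n), compact (B i);
  gm_sub_simplex : forall n (i : 'I_n), B i `<=` simplex R d;
  gm_disjoint : forall n (i j : 'I_n), i != j -> (B i)° `&` (B j)° = set0;
  gm_cover : forall n, (0 < n)%N ->
    \bigcup_(i in [set: 'I_n]) B i = simplex R d;
  gm_design_point : forall n (i : 'I_n), (B i)° (x i);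
  gm_boundary : forall n (i : 'I_n), lebesgue_rV d (boundary (B i)) = 0%E;
  gm_diam : exists C : R, \forall n \near \oo, forall i : 'I_n,
    diam (B i) <= C * n%:R `^ (- d%:R^-1);
  gm_mass : exists C : R, \forall n \near \oo, forall i : 'I_n,
    `|\int[lebesgue_rV d]_(t in B i) f t - n%:R^-1|
      <= C * n%:R `^ (- 1 - d%:R^-1) }.

End Design.

Definition mutually_independent (disp : measure_display)
    (T : measurableType disp) (R : realType) (P : probability T R)
    (I : finType) (X : I -> {RV P >-> R}) : Prop :=
  forall (K : {set I}) (A : I -> set R), (forall i, measurable (A i)) ->
    (P (\bigcap_(i in [set` K]) (X i @^-1` A i)) =
     \prod_(i in K) P (X i @^-1` A i))%E.

(* Main.v *)
Require Import Defs.
From HB Require Import structures.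
From mathcomp Require Import all_boot all_order all_algebra.
From mathcomp Require Import all_classical all_reals all_analysis.
From mathcomp Require Import measurable_realfun ring lra.

Set Implicit Arguments.
Unset Strict Implicit.
Unset Printing Implicit Defensive.

Import Order.TTheory GRing.Theory Num.Theory.
Import numFieldNormedType.Exports.

Local Open Scope classical_set_scope.
Local Open Scope ring_scope.

(* With errors of variance sigma^2(x_i), the variance is sum_i sigma^2(x_i) k_i^2, where
   k_i is the integral of the Dirichlet density K over the cell B_i. Replacing k_i^2 by
   Leb(B_i) times the integral of K^2 over B_i, then Leb(B_i) by 1/(n f(x_i)), and finally
   sigma^2/f at x_i by its value at s, gives n Var = (sigma^2/f)(s) A (1 + o(1)), with A
   the integral of K^2. The first replacement needs a Lipschitz bound for K of order A/b:
   the gradient of K is made of Dirichlet weights with one exponent lowered, and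
   log-concavity bounds the supremum of such a weight w by 2^d int w^2 / int w, an
   explicit ratio of Gamma values. The last one uses that K^2/A is a Dirichlet density
   whose second moments about s are O(b). Finally A is a product of the ratios
   Gamma(2z+1)/Gamma(z+1)^2: the arguments tending to infinity are handled by
   4^z/sqrt(pi z), obtained by comparing the Beta integral of (1-v^2/z)^z with a Gaussian,
   the others by continuity of Gamma. *)

(** * Gamma and Beta integrals *)

(** The point [s] may drift to the boundary of the simplex, and the height of the kernel then
    depends on [J]. Hence all errors are measured relative to A ([dpdf2]), whatever its order, and
    the power of [b] in the result enters once, through the exact identity [dpdf2_rescaled]. The
    slack 1 - |s| is treated as one more coordinate, so that the kernel is a symmetric product of d
    + 1 powers with exponents [p k = bary s k / b], of sum 1/b. This sum gives the Lipschitz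
    constant of order A/b, which a cell of diameter n^(-1/d) = o(b) absorbs; it also makes 4^(1/b)
    cancel the powers of 4 coming from exponents that tend to infinity, leaving 4^(-p_j) for j in
    [J], the origin of 2^(2 lambda_j) in the limit. Lowering an exponent by one requires [1 <= p k];
    for j in [J] this holds eventually because lambda_j exceeds 1. Powers are truncated to zero at
    negative arguments, so that Dirichlet integrals run over the whole space and affine
    substitutions need no care about domains. *)

Section gamma_beta.
Context {R : realType}.
Implicit Types (a c p q t : R).
Notation mu := (@lebesgue_measure R).

(** By uniqueness of Lebesgue measure: [a] times its image under the inverse map has the right value
    on half-open intervals. *)
Lemma ge0_integral_affine a c (f : R -> \bar R) : 0 < a ->
  measurable_fun setT f -> (forall x, 0 <= f x)%E ->
  (\int[mu]_t f t = a%:E * \int[mu]_t f (c + a * t)%R)%E.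
Proof.
move=> a0 mf f0.
pose phi : measurableTypeR R -> measurableTypeR R := fun t => c + a * t.
have mphi : measurable_fun setT phi.
  by apply: measurable_funD => //; exact: measurable_funM.
pose a' : {nonneg R} := NngNum (ltW a0).
have muE A : measurable A -> mu A = pushforward (mscale a' mu) phi A.
  move=> mA; apply: lebesgue_measure_unique => // _ [[x y]] _ <-.
  rewrite /= /pushforward/= /mscale/=.
    have -> : phi @^-1` `]x, y] = `](x - c) / a, (y - c) / a]%classic.
    apply/seteqP; split => t /=; rewrite /phi !in_itv/=
      ltr_pdivrMr// ler_pdivlMr// ltrBlDr lerBrDr (mulrC t) (addrC c) => /andP[? ?];
      exact/andP.
  rewrite !lebesgue_measure_itv/= !lte_fin ltr_pM2r ?invr_gt0// ltrD2r.
  case: ifP => _; last by rewrite mule0.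
  by rewrite -!EFinB -EFinM; congr EFin; field; rewrite gt_eqF.
rewrite -(ge0_integral_mscale _ measurableT a')//; last first.
  exact: (measurableT_comp mf mphi).
rewrite -[X in (integral _ X _)](preimage_setT phi).
rewrite -(ge0_integral_pushforward mphi _ measurableT)//.
by apply: eq_measure_integral => // A mA _; exact: muE.
Qed.

(* [0 `^ 0 = 1], so that [tpow 0] is the indicator of [[0, +oo[]. *)
Definition tpow p t : R := if 0 <= t then t `^ p else 0.

Lemma tpow_ge0 p t : 0 <= tpow p t.
Proof. by rewrite /tpow; case: ifP => // _; exact: powR_ge0. Qed.

Lemma tpow_gt0 p t : 0 < t -> 0 < tpow p t.
Proof. by move=> t0; rewrite /tpow ltW// powR_gt0. Qed.

Lemma tpow0 p : 0 < p -> tpow p 0 = 0.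
Proof. by move=> p0; rewrite /tpow lexx powR0// gt_eqF. Qed.

Lemma tpow_lt0 p t : t < 0 -> tpow p t = 0.
Proof. by move=> t0; rewrite /tpow leNgt t0. Qed.

Lemma tpowD p q t : 0 <= p -> 0 <= q -> tpow (p + q) t = tpow p t * tpow q t.
Proof.
rewrite /tpow => p0 q0; case: ifPn => t0; last by rewrite mul0r.
have [pq|pq] := eqVneq (p + q) 0; last by rewrite powRD// (negbTE pq).
have [/eqP -> /eqP ->] : p == 0 /\ q == 0.
  by apply/andP; rewrite -paddr_eq0// pq.
by rewrite addr0 powRr0 mul1r.
Qed.

Lemma tpowM p a t : 0 < a -> tpow p (a * t) = a `^ p * tpow p t.
Proof.
move=> a0; rewrite /tpow pmulr_rge0//; case: ifP => t0; last by rewrite mulr0.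
by rewrite powRM// ltW.
Qed.

Lemma measurable_tpow p : measurable_fun setT (tpow p).
Proof.
by apply: measurable_fun_ifT => //=; exact: measurable_fun_ler.
Qed.

Lemma measurable_tpow_comp d (T : measurableType d) (f : T -> R) p :
  measurable_fun setT f -> measurable_fun setT (fun x => tpow p (f x)).
Proof. by move=> mf; apply: (measurableT_comp (measurable_tpow p) mf). Qed.

(** The Beta function B(p + 1, q + 1). It is indexed by exponents, as [gamma1] below, and stays in
    the extended reals so that Tonelli applies before finiteness is known. *)
Definition betaf p q : \bar R := (\int[mu]_t (tpow p t * tpow q (1 - t))%:E)%E.

Lemma measurable_tpow_conv c p q :
  measurable_fun setT (fun t => (tpow p t * tpow q (c - t))%:E).
Proof.
apply/measurable_EFinP; apply: measurable_funM; apply: measurable_tpow_comp => //.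
exact: measurable_funB.
Qed.

(** A convolution of truncated powers: the substitution [t = c u] extracts [c ^ (p + q + 1)] and
    leaves the Beta integral. It serves both the Gamma-Beta relation and the induction on the
    dimension. *)
Lemma tpow_conv c p q : 0 <= p -> 0 <= q ->
  (\int[mu]_t (tpow p t * tpow q (c - t))%:E = (tpow (p + q + 1) c)%:E * betaf p q)%E.
Proof.
move=> p0 q0; have [c0|c0|->] := ltgtP c 0.
- rewrite tpow_lt0// mul0e integral0_eq// => t _.
  have [t0|t0] := ltP t 0; first by rewrite tpow_lt0// mul0r.
  by rewrite (@tpow_lt0 q) ?mulr0//; lra.
- rewrite (ge0_integral_affine 0 c0 (measurable_tpow_conv c p q)); last first.
    by move=> t; rewrite lee_fin mulr_ge0 ?tpow_ge0.
  have -> : (fun t => (tpow p (0 + c * t) * tpow q (c - (0 + c * t)))%:E) =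
      (fun t => (c `^ (p + q))%:E * (tpow p t * tpow q (1 - t))%:E)%E.
    apply/funext => t; rewrite add0r (_ : c - c * t = c * (1 - t)); last by ring.
    rewrite !tpowM// -EFinM.
    by rewrite powRD ?(gt_eqF c0) ?implybT//; congr EFin; ring.
  rewrite ge0_integralZl//; last 3 first.
    exact: measurable_tpow_conv.
    by move=> t _; rewrite lee_fin mulr_ge0// tpow_ge0.
    by rewrite lee_fin powR_ge0.
  rewrite muleA -EFinM; congr (_ * _)%E; congr EFin.
  by rewrite /tpow ltW// [RHS]powRD ?(gt_eqF c0) ?implybT// powRr1 ?ltW// mulrC.
- rewrite tpow0 ?mul0e; last by lra.
  (* For [p = q = 0] the integrand equals 1 at the origin, so this null point has to be removed. *)
  rewrite (ge0_negligible_integral (N := [set (0 : measurableTypeR R)]))//; last 3 first.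
    exact: measurable_tpow_conv.
    by move=> t _; rewrite lee_fin mulr_ge0// tpow_ge0.
    exact: lebesgue_measure_set1.
  rewrite integral0_eq// => t [_ /= /eqP t0].
  have [t1|t1] := ltP t 0; first by rewrite tpow_lt0// mul0r.
  by rewrite (@tpow_lt0 q) ?mulr0// sub0r oppr_lt0 lt_neqAle eq_sym t0.
Qed.

Definition gamma1e p : \bar R := (\int[mu]_t (tpow p t * expR (- t))%:E)%E.

Lemma gamma1e_ge0 p : (0 <= gamma1e p)%E.
Proof.
by apply: integral_ge0 => t _; rewrite lee_fin mulr_ge0 ?tpow_ge0 ?expR_ge0.
Qed.

Lemma measurable_gamma1 p :
  measurable_fun setT (fun t => (tpow p t * expR (- t))%:E).
Proof.
apply/measurable_EFinP; apply: measurable_funM; first exact: measurable_tpow.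
exact: measurableT_comp.
Qed.

(** The substitution [c = t + u] in the double integral and Tonelli turn the product into the
    integral of [expR (- c)] against the convolution computed by [tpow_conv]. *)
Lemma gamma1eM p q : 0 <= p -> 0 <= q ->
  (gamma1e p * gamma1e q = gamma1e (p + q + 1) * betaf p q)%E.
Proof.
move=> p0 q0.
pose F (z : measurableTypeR R * measurableTypeR R) : \bar R :=
  (tpow p z.1 * tpow q (z.2 - z.1) * expR (- z.2))%:E.
have F0 z : (0 <= F z)%E.
  by rewrite lee_fin !mulr_ge0 ?tpow_ge0 ?expR_ge0.
have mF : measurable_fun setT F.
  apply/measurable_EFinP; apply: measurable_funM.
    apply: measurable_funM; apply: measurable_tpow_comp => //.
    exact: measurable_funB.
  by apply: (measurableT_comp (@measurable_expR R)); exact: measurableT_comp.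
have gamma1_0 r t : (0 <= (tpow r t * expR (- t))%:E)%E.
  by rewrite lee_fin mulr_ge0 ?tpow_ge0 ?expR_ge0.
transitivity (\int[mu]_t \int[mu]_c F (t, c))%E.
  rewrite {1}/gamma1e -ge0_integralZr ?gamma1e_ge0//; last exact: measurable_gamma1.
  apply: eq_integral => t _; rewrite -ge0_integralZl//; last exact: measurable_gamma1.
  rewrite [LHS](@ge0_integral_affine 1 (- t) _ ltr01); last 2 first.
  - by apply: measurable_funeM; exact: measurable_gamma1.
  - by move=> x; exact: mule_ge0.
  rewrite mul1e; apply: eq_integral => c _.
  rewrite /F/= -EFinM mul1r (addrC (- t)); congr EFin.
  have -> : - c = - t + - (c - t) by ring.
  by rewrite expRD; ring.
rewrite fubini_tonelli//= /gamma1e -ge0_integralZr//; last 2 first.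
- exact: measurable_gamma1.
- by apply: integral_ge0 => t _; rewrite lee_fin mulr_ge0 ?tpow_ge0.
apply: eq_integral => c _.
rewrite [in RHS]EFinM muleAC -tpow_conv// -ge0_integralZr//.
- exact: measurable_tpow_conv.
- by move=> t _; rewrite lee_fin mulr_ge0 ?tpow_ge0.
Qed.

Lemma continuous_tpow p : 0 < p -> continuous (tpow p : R -> R).
Proof.
move=> p0 t; rewrite /continuous_at; have [t0|t0|->] := ltgtP t 0.
- rewrite tpow_lt0//.
  apply: cvg_near_cst; near=> x; rewrite tpow_lt0//; near: x; exact: lt_nbhsl.
- apply: (@cvg_trans _ (x `^ p @[x --> t])); last first.
    rewrite /tpow ltW//.
    have : {for t, continuous (@powR R ^~ p)}; last by [].
    apply/differentiable_continuous/derivable1_diffP.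
    by apply: derivable_powR; rewrite in_itv/= andbT.
  by apply: near_eq_cvg; near=> x; rewrite /tpow ltW//; near: x; exact: lt_nbhsr.
- apply/left_right_continuousP; split; rewrite tpow0//.
    by apply: cvg_near_cst; near=> x; rewrite tpow_lt0.
  apply: (@cvg_trans _ (x `^ p @[x --> (0:R)^'+])); last exact: powR_cvg0.
  by apply: near_eq_cvg; near=> x; rewrite /tpow ltW.
Unshelve. all: by end_near. Qed.

(** With [y = t / (2 p)] one has [t ^ p = (2 p) ^ p * y ^ p], and [ln y <= y] gives
    [y ^ p <= expR (t / 2)]. Half of the decay of [expR (- t)] is thus left to make the Gamma
    integral converge. *)
Lemma tpow_le_expR p : 0 <= p ->
  exists2 C, 0 <= C & forall t, tpow p t <= C * (tpow 0 t * expR (t / 2)).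
Proof.
rewrite le_eqVlt => /orP[/eqP <-|p0].
  exists 1 => // t; rewrite mul1r /tpow; case: ifP => t0; last by rewrite mul0r.
  by rewrite powRr0 mul1r -expR0 ler_expR divr_ge0.
exists ((2 * p) `^ p); first exact: powR_ge0.
move=> t; rewrite /tpow; case: ifP => t0; last by rewrite mul0r mulr0.
rewrite powRr0 mul1r; move: t0; rewrite le_eqVlt => /orP[/eqP <-|t0].
  by rewrite powR0 ?gt_eqF// mulr_ge0 ?powR_ge0 ?expR_ge0.
have y0 : 0 < t / (2 * p) by rewrite divr_gt0//; lra.
rewrite {1}(_ : t = (2 * p) * (t / (2 * p))); last by field; rewrite gt_eqF.
rewrite powRM ?(ltW y0)//; last by lra.
rewrite ler_wpM2l ?powR_ge0// {1}/powR gt_eqF// ler_expR.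
apply: (@le_trans _ _ (p * (t / (2 * p)))).
  by rewrite ler_pM2l// ltW// ln_sublinear.
by rewrite le_eqVlt; apply/orP; left; apply/eqP; field; rewrite gt_eqF.
Qed.

Lemma integrable_gamma1 p : 0 <= p ->
  mu.-integrable setT (EFin \o (fun t => tpow p t * expR (- t))).
Proof.
move=> p0; have [C C0 hC] := tpow_le_expR p0.
apply: (@le_integrable _ _ _ mu setT measurableT _
   (fun t => (C * 2)%:E * (exponential_pdf 2^-1 t)%:E)%E) => //.
- exact: measurable_gamma1.
- move=> t _; rewrite /= lee_fin ger0_norm ?mulr_ge0 ?tpow_ge0 ?expR_ge0//.
  rewrite ger0_norm; last first.
    by rewrite !mulr_ge0// exponential_pdf_ge0// invr_ge0.
  have [t0|t0] := ltP t 0.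
    rewrite tpow_lt0// mul0r !mulr_ge0// exponential_pdf_ge0// invr_ge0//.
  rewrite exponential_pdfE//.
  apply: (@le_trans _ _ (C * (tpow 0 t * expR (t / 2)) * expR (- t))).
    by rewrite ler_wpM2r ?expR_ge0.
  rewrite /tpow t0 powRr0 mul1r -mulrA -expRD le_eqVlt; apply/orP; left; apply/eqP.
  rewrite (_ : t / 2 - t = - 2^-1 * t); last by field.
  by field.
- apply: integrableZl => //; apply: integrable_exponential_pdf.
  by rewrite invr_gt0.
Qed.

Definition gamma1 p : R := fine (gamma1e p).

Lemma gamma1eE p : 0 <= p -> gamma1e p = (gamma1 p)%:E.
Proof.
by move=> p0; rewrite /gamma1 fineK// /gamma1e integral_fune_fin_num//; exact: integrable_gamma1.
Qed.

Lemma Gamma_gamma1 p : Gamma (p + 1) = gamma1 p.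
Proof.
rewrite /Gamma /gamma1 /Rintegral; congr fine.
rewrite integral_itv_obnd_cbnd/=; last first.
  apply: measurable_funTS; apply/measurable_EFinP; apply: measurable_funM => //.
  exact: measurableT_comp.
rewrite /gamma1e integral_mkcond; apply: eq_integral => t _.
rewrite addrK patchE mem_setE in_itv/= andbT /tpow.
by case: ifP => //; rewrite mul0r.
Qed.

Lemma gamma1_gt0 p : 0 <= p -> 0 < gamma1 p.
Proof.
move=> p0; rewrite -lte_fin -gamma1eE// lt0e gamma1e_ge0 andbT.
apply/eqP => gp0.
have : (\int[mu]_t `|(tpow p t * expR (- t))%:E| = 0)%E.
  rewrite -[RHS]gp0; apply: eq_integral => t _; rewrite gee0_abs//.
  by rewrite lee_fin mulr_ge0 ?tpow_ge0 ?expR_ge0.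
move/(ae_eq_integral_abs mu measurableT (measurable_gamma1 p)).
case => N [mN N0 sub].
have : (mu `]0%R, 1%R[%classic <= mu N)%E.
  apply: le_measure; rewrite ?inE//.
  apply: subset_trans sub => t /=; rewrite in_itv/= => /andP[t0 _] /(_ I) /eqP.
  by rewrite eqe mulf_eq0 !gt_eqF ?tpow_gt0 ?expR_gt0.
by rewrite N0 lebesgue_measure_itv/= lte_fin ltr01 oppr0 adde0 lee_fin ler10.
Qed.

(** Finiteness of the Beta integral is a by-product of [gamma1eM]: an infinite value would make a
    product of two finite Gamma integrals infinite. *)
Lemma betaf_gamma1 p q : 0 <= p -> 0 <= q ->
  betaf p q = (gamma1 p * gamma1 q / gamma1 (p + q + 1))%:E.
Proof.
move=> p0 q0; have pq0 : 0 <= p + q + 1 by rewrite !addr_ge0.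
have := gamma1eM p0 q0; rewrite !gamma1eE//.
have : (0 <= betaf p q)%E.
  by apply: integral_ge0 => t _; rewrite lee_fin mulr_ge0 ?tpow_ge0.
case: (betaf p q) => [r| |]//= _.
- by rewrite -!EFinM => -[->]; congr EFin; field; rewrite gt_eqF ?gamma1_gt0.
- by rewrite gt0_muley ?lte_fin ?gamma1_gt0.
Qed.

Lemma betaf_p0 p : 0 <= p -> betaf p 0 = (p + 1)^-1%:E.
Proof.
move=> p0; have p10 : 0 < p + 1 by rewrite ltr_wpDl.
transitivity (\int[mu]_(t in `[0%R, 1%R]) (tpow p t)%:E)%E.
  rewrite integral_mkcond; apply: eq_integral => t _.
  rewrite patchE mem_setE in_itv/= /tpow powRr0 subr_ge0.
  by case: (0 <= t); case: (t <= 1); rewrite ?(mul0r, mulr1, mulr0).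
(* [tpow 0] jumps at the origin, out of reach of [continuous_tpow], so the constant integrand is
   treated apart. *)
have [->|pn0] := eqVneq p 0.
  transitivity (\int[mu]_(t in `[0%R, 1%R]) (cst 1%:E t))%E.
    by apply: eq_integral => t; rewrite inE/= in_itv/= /tpow powRr0 => /andP[-> _].
  by rewrite integral_cst//= lebesgue_measure_itv/= lte_fin ltr01 mul1e
    oppr0 adde0 add0r invr1.
have pp : 0 < p by rewrite lt_neqAle eq_sym pn0.
pose F t := (p + 1)^-1 * tpow (p + 1) t.
have dF (t : R) : 0 < t -> is_derive t 1 F (tpow p t).
  move=> t0; rewrite /F.
  apply: (@near_eq_is_derive _ _ _ (fun t => (p + 1)^-1 * t `^ (p + 1))) => //.
    near=> x; rewrite /tpow ltW//; near: x; exact: lt_nbhsr.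
  have -> : tpow p t = (p + 1)^-1 *: ((p + 1) * t `^ (p + 1 - 1)).
    by rewrite addrK /tpow ltW// scalerA mulVf ?gt_eqF// scale1r.
  by apply: (@is_deriveZ _ _ _ (@powR R ^~ (p + 1))); exact: is_derive1_powR.
have cF : continuous F.
  move=> t; apply: cvgM; first exact: cvg_cst.
  exact: continuous_tpow.
rewrite (@continuous_FTC2 _ (tpow p) F)//.
- by rewrite /F tpow0// mulr0 sube0 /tpow ler01 powR1 mulr1.
- by apply: continuous_subspaceT; exact: continuous_tpow.
- split.
  + by move=> t; rewrite in_itv/= => /andP[t0 _]; case: (dF _ t0).
  + by apply: cvg_at_right_filter; exact: cF.
  + by apply: cvg_at_left_filter; exact: cF.
- move=> t; rewrite in_itv/= => /andP[t0 _].
  by rewrite derive1E; case: (dF _ t0).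
Unshelve. all: by end_near. Qed.

Lemma gamma1_0 : gamma1 0 = 1.
Proof.
apply: EFin_inj; rewrite -gamma1eE// -(@integral_exponential_pdf R 1 ltr01).
apply: eq_integral => t _; congr EFin; rewrite /tpow; case: ifPn => t0.
  by rewrite exponential_pdfE// powRr0 !mul1r mulN1r.
by rewrite mul0r lt0_exponential_pdf// ltNge.
Qed.

(** The functional equation of Gamma, read off from B(p + 1, 1) = 1/(p + 1) instead of an
    integration by parts on an unbounded interval. *)
Lemma gamma1S p : 0 <= p -> gamma1 (p + 1) = (p + 1) * gamma1 p.
Proof.
move=> p0; have p10 : 0 < p + 1 by rewrite ltr_wpDl.
have := betaf_p0 p0; rewrite betaf_gamma1// gamma1_0 addr0 mulr1 => -[] h.
have -> : gamma1 p = (p + 1)^-1 * gamma1 (p + 1) by rewrite -h divfK// gt_eqF ?gamma1_gt0 ?ltW.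
by rewrite mulrA divff ?mul1r// gt_eqF.
Qed.

End gamma_beta.

(** * Gamma at finite arguments and central binomial ratios at infinity *)

Section gamma_asymptotics.
Context {R : realType}.
Implicit Types (a c p q t v z : R).
Notation mu := (@lebesgue_measure R).
Notation gauss := (@gauss_fun R).

(** Dominated convergence for exponents in []0, p + 1[]: the power of [t] is at most 1 when [t <= 1]
    and at most [t ^ (p + 1)] otherwise, so the sum of the two extreme integrands dominates. *)
Lemma continuous_gamma1 p : 0 < p -> {for p, continuous gamma1}.
Proof.
move=> p0; pose f l t := tpow l t * expR (- t).
have -> : gamma1 = (fun l => \int[mu]_(t in setT) f l t) by [].
have p1 : 0 <= p + 1 by rewrite addr_ge0// ltW.
apply: (@continuity_under_integral _ _ _ mu f setT measurableT 0 (p + 1) _ _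
  (fun t => f 0 t + f (p + 1) t)).
- by move=> l /=; rewrite in_itv/= => /andP[l0 _]; apply: integrable_gamma1; exact: ltW.
- apply/aeW => t _ l; rewrite inE/= in_itv/= => /andP[l0 _].
  apply: cvgM; last exact: cvg_cst.
  have [t0|t0|->] := ltgtP t 0.
  + by rewrite tpow_lt0//; apply: cvg_near_cst; apply/nearW => x; rewrite tpow_lt0.
  + rewrite /tpow (ltW t0) /powR gt_eqF//.
    apply: (cvg_comp (fun l => l * ln t) expR); last exact: continuous_expR.
    by apply: cvgM; [exact: cvg_id|exact: cvg_cst].
  + rewrite tpow0//; apply: cvg_near_cst; near=> x; rewrite tpow0//.
    by near: x; exact: lt_nbhsr.
- exact: (integrableD measurableT (integrable_gamma1 (lexx 0)) (integrable_gamma1 p1)).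
- move=> l; rewrite /= in_itv/= => /andP[l0 lp]; apply/aeW => t _.
  rewrite ger0_norm ?mulr_ge0 ?tpow_ge0 ?expR_ge0//.
  rewrite /f -mulrDl ler_wpM2r ?expR_ge0// /tpow; case: ifP => t0; last by rewrite addr0.
  rewrite powRr0; have [t1|t1] := leP t 1.
    apply: le_trans (_ : 1 <= _); last by rewrite lerDl powR_ge0.
    move: t0; rewrite le_eqVlt => /orP[/eqP <-|t0]; first by rewrite powR0 ?gt_eqF.
    by rewrite -[leRHS](powRr0 t) ger_powR ?t0// ltW.
  apply: le_trans (_ : t `^ (p + 1) <= _); last by rewrite lerDr.
  by rewrite ler_powR// ltW.
- by apply/mem_set; rewrite /= in_itv/= p0 ltrDl ltr01.
Unshelve. all: by end_near. Qed.

Lemma measurable_beta_sqr c p :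
  measurable_fun setT (fun v : R => (tpow p (1 - v ^+ 2 / c))%:E).
Proof.
apply/measurable_EFinP; apply: measurable_tpow_comp.
by apply: measurable_funB => //; apply: measurable_funM => //; exact: measurable_funX.
Qed.

(** The substitution [t = 1/2 + v / (2 sqrt z)] centres the Beta integral at its peak and rescales
    it: [4 t (1 - t)] becomes [1 - v ^ 2 / z]. *)
Lemma betaf_sqr z : 0 < z ->
  (betaf z z = ((2 * Num.sqrt z)^-1 * (4 `^ z)^-1)%:E *
    \int[mu]_v (tpow z (1 - v ^+ 2 / z))%:E)%E.
Proof.
move=> z0; have sz0 : 0 < Num.sqrt z by rewrite sqrtr_gt0.
have a0 : 0 < (2 * Num.sqrt z)^-1 by rewrite invr_gt0 mulr_gt0.
rewrite /betaf (ge0_integral_affine 2^-1 a0 (measurable_tpow_conv 1 z z)); last first.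
  by move=> t; rewrite lee_fin mulr_ge0 ?tpow_ge0.
rewrite EFinM -muleA; congr (_ * _)%E.
rewrite -(ge0_integralZl mu measurableT (measurable_beta_sqr z z)); first last.
- by rewrite lee_fin invr_ge0 powR_ge0.
- by move=> v _; rewrite lee_fin tpow_ge0.
apply: eq_integral => v _; rewrite -EFinM; congr EFin.
set t := _ + _.
have -> : 1 - v ^+ 2 / z = 4 * (t * (1 - t)).
  rewrite -[X in _ / X](@sqr_sqrtr _ z) ?ltW// /t.
  by field; rewrite gt_eqF.
rewrite tpowM// mulrA mulVf ?gt_eqF ?powR_gt0// mul1r /tpow.
have [t0|t0] := leP 0 t; have [t1|t1] := leP 0 (1 - t); last by lra.
- by rewrite mulr_ge0// powRM.
- by rewrite mulr0; case: ifPn => //; rewrite pmulr_rge0; lra.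
- by rewrite mul0r; case: ifPn => //; rewrite pmulr_lge0; lra.
Qed.

Lemma tpow_le_gauss z v : 0 < z -> tpow z (1 - v ^+ 2 / z) <= gauss v.
Proof.
move=> z0; rewrite /tpow; case: ifP => [|_]; last exact: gauss_fun_ge0.
rewrite le_eqVlt => /orP[/eqP <-|h]; first by rewrite powR0 ?gauss_fun_ge0 ?gt_eqF.
rewrite /powR gt_eqF// /gauss_fun ler_expR.
have := @le_ln1Dx R (- (v ^+ 2 / z)).
rewrite -subr_gt0 opprK addrC => /(_ h) hl.
apply: le_trans (_ : z * (- (v ^+ 2 / z)) <= _); first by rewrite ler_pM2l.
by rewrite le_eqVlt; apply/orP; left; apply/eqP; field; rewrite gt_eqF.
Qed.

(** The inequality [ln (1 + u) <= u] again, now at the inverse of [y = 1 - v ^ 2 / z]: it gives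
    [ln y >= 1 - 1 / y], and [z (1 - 1 / y) = - v ^ 2 / y]. *)
Lemma tpow_ge_gauss z v : 0 < z -> 0 < 1 - v ^+ 2 / z ->
  expR (- (v ^+ 2 / (1 - v ^+ 2 / z))) <= tpow z (1 - v ^+ 2 / z).
Proof.
move=> z0 h; rewrite /tpow (ltW h) /powR gt_eqF// ler_expR.
set y := 1 - _ in h *.
have := @le_ln1Dx R (y^-1 - 1).
rewrite (_ : 1 + (y^-1 - 1) = y^-1); last by ring.
rewrite ltrBrDr addNr invr_gt0 => /(_ h).
rewrite lnV ?posrE// => hl.
apply: le_trans (_ : z * (1 - y^-1) <= _).
  rewrite le_eqVlt; apply/orP; left; apply/eqP.
  have hv : v ^+ 2 = z * (1 - y) by rewrite /y; field; rewrite gt_eqF.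
  by rewrite hv; field; rewrite gt_eqF.
by rewrite ler_pM2l//; lra.
Qed.

Definition beta_sqr z : R := fine (\int[mu]_v (tpow z (1 - v ^+ 2 / z))%:E)%E.

Lemma beta_sqrE z : 0 < z ->
  (\int[mu]_v (tpow z (1 - v ^+ 2 / z))%:E = (beta_sqr z)%:E)%E.
Proof.
move=> z0; rewrite /beta_sqr fineK// integral_fune_fin_num//.
apply: le_integrable integrableT_gauss => //; first exact: measurable_beta_sqr.
move=> v _ /=; rewrite lee_fin !ger0_norm ?tpow_ge0 ?gauss_fun_ge0//.
exact: tpow_le_gauss.
Qed.

Lemma cvg_tpow_gauss (z : R^nat) v : z n @[n --> \oo] --> +oo ->
  tpow (z n) (1 - v ^+ 2 / z n) @[n --> \oo] --> gauss v.
Proof.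
move=> zoo; have zgt A : \forall n \near \oo, A < z n by move/cvgryPgt : zoo; exact.
have uz : v ^+ 2 / z n @[n --> \oo] --> 0.
  rewrite -(mulr0 (v ^+ 2)); apply: cvgM; first exact: cvg_cst.
  apply/gtr0_cvgV0 => //; near=> n; near: n; exact: zgt.
have yz : 1 - v ^+ 2 / z n @[n --> \oo] --> (1 : R).
  by rewrite -[X in _ --> X](subr0 1); apply: cvgB => //; exact: cvg_cst.
apply: (@squeeze_cvgr _ _ _ _
  (fun n => expR (- (v ^+ 2 / (1 - v ^+ 2 / z n)))) (fun=> gauss v)).
- near=> n; have zn : 0 < z n by near: n; exact: zgt.
  rewrite tpow_le_gauss// andbT tpow_ge_gauss//; near: n.
  by apply: (cvgr_gt 1 yz); exact: ltr01.
- apply: (cvg_comp _ expR); last exact: continuous_expR.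
  apply: cvgN; rewrite -[X in _ --> X](divr1 (v ^+ 2)).
  by apply: cvgM; [exact: cvg_cst|apply: cvgV => //; exact: oner_neq0].
- exact: cvg_cst.
Unshelve. all: by end_near. Qed.

Lemma cvg_beta_sqr (z : R^nat) : z n @[n --> \oo] --> +oo ->
  beta_sqr (z n) @[n --> \oo] --> Num.sqrt pi.
Proof.
move=> zoo; have zgt A : \forall n \near \oo, A < z n by move/cvgryPgt : zoo; exact.
(* The Gaussian domination needs a positive parameter at every index, while [z n] is positive only
   eventually. *)
pose y n := Num.max 1 (z n).
have y0 n : 0 < y n by rewrite lt_max ltr01.
have yoo : y n @[n --> \oo] --> +oo.
  apply/cvgryPgt => A; near=> n; rewrite lt_max; apply/orP; right.
  by near: n; exact: zgt.
apply: (@cvg_trans _ (beta_sqr (y n) @[n --> \oo])).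
  apply: near_eq_cvg; near=> n; rewrite /y; congr beta_sqr; apply/max_idPr.
  by apply: ltW; near: n; exact: zgt.
apply: fine_cvg; rewrite -integralT_gauss.
have mf n : measurable_fun setT (fun v => (tpow (y n) (1 - v ^+ 2 / y n))%:E).
  exact: measurable_beta_sqr.
have cf : {ae mu, forall v, setT v ->
    (tpow (y n) (1 - v ^+ 2 / y n))%:E @[n --> \oo] --> (gauss v)%:E}.
  apply/aeW => v _; apply: cvg_EFin; first by near=> n.
  exact: cvg_tpow_gauss.
have bf : {ae mu, forall v n, setT v ->
    (`|(tpow (y n) (1 - v ^+ 2 / y n))%:E| <= (gauss v)%:E)%E}.
  apply/aeW => v n _ /=; rewrite lee_fin ger0_norm ?tpow_ge0//.
  exact: tpow_le_gauss.
have mg : measurable_fun setT (EFin \o gauss).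
  by apply/measurable_EFinP; exact: measurable_gauss_fun.
by have [_ _] := @dominated_convergence _ _ _ mu setT measurableT
  _ _ _ mf mg cf integrableT_gauss bf.
Unshelve. all: by end_near. Qed.

(** The central binomial coefficient, 2z choose z, at a real argument. *)
Definition gamma1_ratio z : R := gamma1 (2 * z) / gamma1 z ^+ 2.

(* This tends to [1] at infinity: it is Stirling's formula for central binomial
   coefficients. *)
Definition gamma1_rho z : R := gamma1_ratio z * Num.sqrt (pi * z) * (4 `^ z)^-1.

Lemma gamma1_ratio_gt0 z : 0 <= z -> 0 < gamma1_ratio z.
Proof. by move=> z0; rewrite divr_gt0 ?exprn_gt0 ?gamma1_gt0// mulr_ge0. Qed.

(** Since B(z + 1, z + 1) = Gamma(z + 1)^2 / ((2z + 1) Gamma(2z + 1)), the ratio is the inverse of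
    [2z + 1] times a Beta integral; the factor [z / (z + 1/2)] comes from that [2z + 1]. *)
Lemma gamma1_rho_beta z : 0 < z ->
  gamma1_rho z = Num.sqrt pi * (z / (z + 2^-1)) / beta_sqr z.
Proof.
move=> z0; have := betaf_sqr z0; rewrite betaf_gamma1 ?ltW// beta_sqrE// -EFinM => -[].
rewrite (_ : z + z = 2 * z); last by ring.
rewrite gamma1S ?mulr_ge0 ?(ltW z0)// => h.
have g1 := gamma1_gt0 (ltW z0).
have g2 : 0 < gamma1 (2 * z) by rewrite gamma1_gt0// mulr_ge0// ltW.
have p4 : 0 < 4 `^ z by rewrite powR_gt0.
have sz : 0 < Num.sqrt z by rewrite sqrtr_gt0.
have b0 : beta_sqr z = 2 * Num.sqrt z * 4 `^ z * (gamma1 z * gamma1 z / ((2 * z + 1) * gamma1 (2 * z))).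
  rewrite h; move: p4 sz; clear; move: (4 `^ z) (Num.sqrt z) => P S P0 S0.
  by field; rewrite !gt_eqF.
have z21 : 0 < 2 * z + 1 by lra.
have e : z / (z + 2^-1) = 2 * Num.sqrt z ^+ 2 / (2 * z + 1).
  by rewrite sqr_sqrtr ?(ltW z0)//; field; lra.
rewrite b0 e /gamma1_rho /gamma1_ratio sqrtrM ?pi_ge0//.
move: z21 g1 g2 p4 sz; clear; set A := 2 * z + 1; move: A => A.
move: (gamma1 z) (gamma1 (2 * z)) (4 `^ z) (Num.sqrt z) => G G2 P S A0 G0 G20 P0 S0.
by field; rewrite !gt_eqF.
Qed.

Lemma cvg_gamma1_rho (z : R^nat) : z n @[n --> \oo] --> +oo ->
  gamma1_rho (z n) @[n --> \oo] --> (1 : R).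
Proof.
move=> zoo; have zgt A : \forall n \near \oo, A < z n by move/cvgryPgt : zoo; exact.
apply: (@cvg_trans _
  (Num.sqrt pi * (z n / (z n + 2^-1)) / beta_sqr (z n) @[n --> \oo])).
  apply: near_eq_cvg; near=> n; apply/esym/gamma1_rho_beta.
  by near: n; exact: zgt.
have p0 : Num.sqrt pi != 0 :> R by rewrite gt_eqF ?sqrtr_gt0 ?pi_gt0.
suff : Num.sqrt pi * (z n / (z n + 2^-1)) / beta_sqr (z n) @[n --> \oo] -->
    Num.sqrt pi * 1 / Num.sqrt pi by rewrite mulr1 divff.
apply: cvgM; last by apply: cvgV => //; exact: cvg_beta_sqr.
apply: cvgM; first exact: cvg_cst.
apply: (@cvg_trans _ (1 - 2^-1 / (z n + 2^-1) @[n --> \oo])).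
  apply: near_eq_cvg; near=> n.
  have zn : 0 < z n by near: n; exact: zgt.
  by field; lra.
suff : 1 - 2^-1 / (z n + 2^-1) @[n --> \oo] --> 1 - 2^-1 * (0 : R).
  by rewrite mulr0 subr0.
apply: cvgB; first exact: cvg_cst.
apply: cvgM; first exact: cvg_cst.
apply/gtr0_cvgV0; first by near=> n; rewrite addr_gt0//; near: n; exact: zgt.
apply/cvgryPgt => A; near=> n; rewrite -ltrBlDr; near: n; exact: zgt.
Unshelve. all: by end_near. Qed.
End gamma_asymptotics.

(** * The Dirichlet integral *)

Section dirichlet_integral.
Context {R : realType}.
Notation mu := (@lebesgue_measure R).

Lemma measurable_row_pair (d : nat) (t : R) :
  measurable_fun setT (fun v : 'rV[R]_d => row_cons (t, v)).
Proof.
apply: (measurableT_comp (@measurable_row_cons R d)).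
exact: measurable_pair1.
Qed.

Lemma integral_lebesgue_rVS (d : nat) (h : 'rV[R]_d.+1 -> \bar R) :
  measurable_fun setT h -> (forall v, 0 <= h v)%E ->
  (\int[lebesgue_rV d.+1]_v h v =
   \int[mu]_t \int[lebesgue_rV d]_v h (row_cons (t, v)))%E.
Proof.
move=> mh h0; rewrite /= /lebesgue_cons.
rewrite (ge0_integral_pushforward (@measurable_row_cons R d) _ measurableT mh);
  last by move=> v _; exact: h0.
have mhc := measurableT_comp mh (@measurable_row_cons R d).
rewrite preimage_setT (fubini_tonelli1 (h \o @row_cons R d) mhc)//.
by move=> z; exact: h0.
Qed.

Lemma measurable_rV_affine (d : nat) (a : R) (c : 'rV[R]_d) :
  measurable_fun setT (fun v : 'rV[R]_d => c + a *: v).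
Proof.
apply: measurable_fun_rV => i.
rewrite (_ : (fun x => _) = (fun v : 'rV[R]_d => c 0 i + a * v 0 i)); last first.
  by apply/funext => v; rewrite !mxE.
apply: measurable_funD => //; apply: measurable_funM => //.
exact: measurable_rV_coord.
Qed.

(** The scalar substitution, one coordinate at a time. With [a = 1/2] its Jacobian is the source of
    the constant [2 ^+ d] in [dweight_le]. *)
Lemma ge0_integral_rV_affine (d : nat) (a : R) (c : 'rV[R]_d)
    (h : 'rV[R]_d -> \bar R) : 0 < a ->
  measurable_fun setT h -> (forall v, 0 <= h v)%E ->
  (\int[lebesgue_rV d]_v h v = (a ^+ d)%:E * \int[lebesgue_rV d]_v h (c + a *: v)%R)%E.
Proof.
move=> a0; elim: d c h => [|d IH] c h mh h0.
  by rewrite /= expr0 mul1e; apply: eq_integral => v _; rewrite [in RHS](thinmx0 (c + _)) (thinmx0 v).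
rewrite integral_lebesgue_rVS// integral_lebesgue_rVS; last 2 first.
- by apply: (measurableT_comp mh); exact: measurable_rV_affine.
- by move=> v.
have mI (h' : 'rV[R]_d.+1 -> \bar R) : measurable_fun setT h' ->
    (forall v, 0 <= h' v)%E ->
    measurable_fun setT (fun t : measurableTypeR R => \int[lebesgue_rV d]_v h' (row_cons (t, v)))%E.
  move=> mh' h'0.
  apply: (measurable_fun_fubini_tonelli_F (h' \o @row_cons R d)).
    exact: (measurableT_comp mh' (@measurable_row_cons R d)).
  by move=> z; exact: h'0.
have I0 t : (0 <= \int[lebesgue_rV d]_v h (row_cons (t, v)))%E.
  by apply: integral_ge0.
rewrite (ge0_integral_affine (c 0 0) a0 (mI _ mh h0)); last exact: I0.
rewrite exprS EFinM -muleA; congr (_ * _)%E.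
rewrite -(ge0_integralZl mu measurableT); first last.
- by rewrite lee_fin exprn_ge0 ?ltW.
- by move=> t _; apply: integral_ge0.
- apply: (mI (fun v => h (c + a *: v))); last by move=> v; exact: h0.
  by apply: (measurableT_comp mh); exact: measurable_rV_affine.
apply: eq_integral => t _.
rewrite (IH (\row_j c 0 (lift ord0 j)) (fun v => h (row_cons (c 0 0 + a * t, v)))); last 2 first.
- by apply: (measurableT_comp mh); exact: measurable_row_pair.
- by move=> v.
congr (_ * _)%E; apply: eq_integral => v _; congr h.
apply/rowP => i; case: (fintype.unliftP ord0 i) => [j|] ->.
  apply: (etrans (row_consS (_, _) j)); rewrite /= [LHS]mxE [X in X + _ = _]mxE [X in _ + X = _]mxE.
  rewrite [RHS]mxE [X in _ = _ + X]mxE; congr (_ + _ * _).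
  by symmetry; apply: (row_consS (_, _) j).
apply: (etrans (row_cons0 (_, _))); rewrite /= [RHS]mxE [X in _ = _ + X]mxE; congr (_ + _ * _).
by symmetry; apply: (row_cons0 (_, _)).
Qed.

(** The d + 1 barycentric coordinates. The plain sum, in place of [l1norm], makes the slack affine
    on the whole space; the simplex is the set where all of them are nonnegative. *)
Definition bary (d : nat) (x : 'rV[R]_d) (k : 'I_d.+1) : R :=
  if fintype.unlift ord0 k is Some j then x 0 j else 1 - \sum_(j < d) x 0 j.

Lemma bary0 (d : nat) (x : 'rV[R]_d) : bary x ord0 = 1 - \sum_(j < d) x 0 j.
Proof. by rewrite /bary unlift_none. Qed.

Lemma baryS (d : nat) (x : 'rV[R]_d) (j : 'I_d) : bary x (lift ord0 j) = x 0 j.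
Proof. by rewrite /bary liftK. Qed.

Lemma sum_bary (d : nat) (x : 'rV[R]_d) : \sum_k bary x k = 1.
Proof.
rewrite big_ord_recl bary0 (eq_bigr _ (fun j _ => baryS x j)).
by rewrite subrK.
Qed.

(* Unnormalised Dirichlet density with parameters [p k + 1]; index [0] is the slack
   coordinate. *)
Definition dweight (d : nat) (p : 'I_d.+1 -> R) (x : 'rV[R]_d) : R :=
  \prod_k tpow (p k) (bary x k).

Lemma dweight_ge0 (d : nat) (p : 'I_d.+1 -> R) x : 0 <= dweight p x.
Proof. by apply: prodr_ge0 => k _; exact: tpow_ge0. Qed.

Lemma measurable_bary (d : nat) k : measurable_fun setT (@bary d ^~ k).
Proof.
case: (fintype.unliftP ord0 k) => [j|] ->.
  under eq_fun do rewrite baryS; exact: measurable_rV_coord.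
under eq_fun do rewrite bary0.
apply: measurable_funB => //; apply: measurable_sum => j.
exact: measurable_rV_coord.
Qed.

Lemma measurable_dweight (d : nat) (p : 'I_d.+1 -> R) : measurable_fun setT (dweight p).
Proof.
apply: measurable_prod => k _; apply: measurable_tpow_comp; exact: measurable_bary.
Qed.

Lemma measurable_dirichlet (d : nat) (a : 'I_d -> R) q c :
  measurable_fun setT (fun v : 'rV[R]_d =>
    (\prod_(j < d) tpow (a j) (v 0 j) * tpow q (c - \sum_(j < d) v 0 j))%:E).
Proof.
apply/measurable_EFinP; apply: measurable_funM.
  by apply: measurable_prod => j _; apply: measurable_tpow_comp; exact: measurable_rV_coord.
apply: measurable_tpow_comp; apply: measurable_funB => //.
by apply: measurable_sum => j; exact: measurable_rV_coord.
Qed.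

(** Fixing the first coordinate to [t] leaves a simplex of size [c - t], which is why the total mass
    [c] is kept general in the induction; the remaining integral in [t] is a convolution of two
    powers. *)
Lemma dirichlet_integral (d : nat) (a : 'I_d -> R) q c :
  (forall j, 0 <= a j) -> 0 <= q ->
  (\int[lebesgue_rV d]_v
     (\prod_(j < d) tpow (a j) (v 0%R j) * tpow q (c - \sum_(j < d) v 0%R j))%:E =
   (tpow (\sum_(j < d) a j + q + d%:R) c *
     ((\prod_(j < d) gamma1 (a j)) * gamma1 q / gamma1 (\sum_(j < d) a j + q + d%:R)))%:E)%E.
Proof.
elim: d a q c => [|d IH] a q c a0 q0.
  rewrite /= integral_dirac; last 2 first.
  - exact: measurableT.
  - exact: measurable_dirichlet.
  rewrite diracE mem_set// mul1e !big_ord0 subr0 !mul1r add0r addr0.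
  by rewrite divff ?mulr1// gt_eqF ?gamma1_gt0.
rewrite integral_lebesgue_rVS; last 2 first.
- exact: measurable_dirichlet.
- move=> v; rewrite lee_fin mulr_ge0 ?tpow_ge0//.
  by apply: prodr_ge0 => j _; exact: tpow_ge0.
set Q := \sum_(j < d) a (lift ord0 j) + q + d%:R.
have Q0 : 0 <= Q by rewrite /Q !addr_ge0// sumr_ge0.
set C := \prod_(j < d) gamma1 (a (lift ord0 j)) * gamma1 q / gamma1 Q.
have C0 : 0 <= C.
  rewrite /C divr_ge0 ?mulr_ge0 ?(ltW (gamma1_gt0 _))//.
  by apply: prodr_ge0 => j _; rewrite ltW ?gamma1_gt0.
transitivity (\int[mu]_t (C%:E * (tpow (a ord0) t * tpow Q (c - t))%:E))%E.
  apply: eq_integral => t _.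
  transitivity (\int[lebesgue_rV d]_v ((tpow (a ord0) t)%:E *
     (\prod_(j < d) tpow (a (lift ord0 j)) (v 0%R j) *
      tpow q ((c - t) - \sum_(j < d) v 0%R j))%:E))%E.
    apply: eq_integral => v _; rewrite -EFinM; congr EFin.
    rewrite !big_ord_recl [RHS]mulrA -[in RHS]addrA -[in RHS]opprD.
    congr (_ * _ * _).
    + by congr tpow; exact: (row_cons0 (_, _)).
    + by apply: eq_bigr => j _; congr tpow; exact: (row_consS (_, _) j).
    + congr (tpow _ (_ - (_ + _))); first exact: (row_cons0 (_, _)).
      by apply: eq_bigr => j _; exact: (row_consS (_, _) j).
  rewrite (ge0_integralZl (lebesgue_rV d) measurableT
    (measurable_dirichlet (fun j => a (lift ord0 j)) q (c - t))); last 2 first.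
  - move=> v _; rewrite lee_fin mulr_ge0 ?tpow_ge0//.
    by apply: prodr_ge0 => j _; exact: tpow_ge0.
  - by rewrite lee_fin tpow_ge0.
  rewrite IH// -EFinM -EFinM -/Q -/C; congr EFin.
  by rewrite mulrA mulrC.
rewrite (ge0_integralZl mu measurableT (measurable_tpow_conv c (a ord0) Q)); last 2 first.
- by move=> t _; rewrite lee_fin mulr_ge0 ?tpow_ge0.
- by rewrite lee_fin.
rewrite tpow_conv// betaf_gamma1// -!EFinM; congr EFin.
have -> : \sum_(j < d.+1) a j + q + d.+1%:R = a ord0 + Q + 1.
  by rewrite big_ord_recl /Q -natr1; ring.
rewrite big_ord_recl mulrCA; congr (_ * _).
have : gamma1 Q != 0 by rewrite gt_eqF ?gamma1_gt0.
have : gamma1 (a ord0 + Q + 1) != 0.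
  by apply: lt0r_neq0; apply: gamma1_gt0; do 2 apply: addr_ge0 => //.
rewrite /C; generalize (\prod_(j < d) gamma1 (a (lift ord0 j))) (gamma1 q) (gamma1 Q) (gamma1 (a ord0))
  (gamma1 (a ord0 + Q + 1)); clear => x1 x2 x3 x4 x5 x50 x30.
by field; rewrite x30 x50.
Qed.
End dirichlet_integral.

(** * Dirichlet weights: mass, shifted exponents, supremum *)

Section dirichlet_weight.
Context {R : realType} {d : nat}.
Implicit Types (p q : 'I_d.+1 -> R) (x y : 'rV[R]_d) (k : 'I_d.+1).
Notation mu := (@lebesgue_rV R d).

(** The d + 1 Dirichlet parameters [p k + 1] add up to [\sum_k p k + d + 1]; only [d] appears
    because [gamma1] is Gamma shifted by one. *)
Definition dmass p : R := (\prod_k gamma1 (p k)) / gamma1 (\sum_k p k + d%:R).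

Lemma dmass_gt0 p : (forall k, 0 <= p k) -> 0 < dmass p.
Proof.
move=> p0; apply: divr_gt0; first by apply: prodr_gt0 => k _; exact: gamma1_gt0.
by apply: gamma1_gt0; rewrite addr_ge0// sumr_ge0.
Qed.

Lemma integral_dweight p : (forall k, 0 <= p k) ->
  (\int[mu]_v (dweight p v)%:E = (dmass p)%:E)%E.
Proof.
move=> p0.
transitivity (\int[mu]_v (\prod_(j < d) tpow (p (lift ord0 j)) (v 0%R j) *
    tpow (p ord0) (1 - \sum_(j < d) v 0%R j))%:E)%E.
  apply: eq_integral => v _; congr EFin.
  rewrite /dweight big_ord_recl bary0 mulrC; congr (_ * _).
  by apply: eq_bigr => j _; rewrite baryS.
rewrite dirichlet_integral//; congr EFin.
rewrite /tpow ler01 powR1 mul1r /dmass !big_ord_recl [gamma1 (p ord0) * _]mulrC.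
by rewrite [p ord0 + _]addrC.
Qed.

Lemma integrable_dweight p : (forall k, 0 <= p k) ->
  mu.-integrable setT (EFin \o dweight p).
Proof.
move=> p0; apply/integrableP; split.
  by apply/measurable_EFinP; exact: measurable_dweight.
under eq_integral => v _ do rewrite /= (ger0_norm (dweight_ge0 _ _)).
by rewrite integral_dweight// ltry.
Qed.

Lemma dweightD p q x : (forall k, 0 <= p k) -> (forall k, 0 <= q k) ->
  dweight (fun k => p k + q k) x = dweight p x * dweight q x.
Proof.
move=> p0 q0; rewrite /dweight -big_split; apply: eq_bigr => k _ /=.
by rewrite tpowD.
Qed.

(* Shifting one exponent is how derivatives and coordinate moments of the weight
   reduce to [dmass]. *)
Definition pbump p k a : 'I_d.+1 -> R := fun i => p i + (if i == k then a else 0).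

Lemma sum_pbump p k a : \sum_i pbump p k a i = \sum_i p i + a.
Proof. by rewrite big_split/= -big_mkcond big_pred1_eq. Qed.

Lemma pbump_ge0 p k a : (forall i, 0 <= p i) -> 0 <= p k + a ->
  forall i, 0 <= pbump p k a i.
Proof. by move=> p0 pa i; rewrite /pbump; case: eqP => [->//|_]; rewrite addr0. Qed.

(** By [dweight_pbump1], the factor next to [dmass p] is the mean of the k-th barycentric coordinate
    under the Dirichlet law. *)
Lemma dmass_pbump1 p k : (forall i, 0 <= p i) ->
  dmass (pbump p k 1) = dmass p * ((p k + 1) / (\sum_i p i + d%:R + 1)).
Proof.
move=> p0; have S0 : 0 <= \sum_i p i + d%:R by rewrite addr_ge0// sumr_ge0.
rewrite /dmass sum_pbump addrAC gamma1S// (bigD1 k)//= [X in _ = X / _ * _](bigD1 k)//=.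
rewrite /pbump eqxx gamma1S//.
under eq_bigr => i /negPf ik do rewrite ik addr0.
rewrite invfM; ring.
Qed.

Lemma dweight_pbump1 p k x : (forall i, 0 <= p i) ->
  dweight (pbump p k 1) x = dweight p x * bary x k.
Proof.
move=> p0; rewrite /dweight (bigD1 k)//= [X in _ = X * _](bigD1 k)//=.
rewrite /pbump eqxx; under eq_bigr => i /negPf ik do rewrite ik addr0.
rewrite mulrAC; congr (_ * _); rewrite /tpow; case: ifP => h; last by rewrite mul0r.
rewrite powRD ?powRr1//; apply/implyP => /eqP e; have := p0 k; lra.
Qed.

(** The inequality of arithmetic and geometric means; truncation makes the left side zero as soon as
    one argument is negative. *)
Lemma tpow_mid (p a b : R) : 0 <= p ->
  tpow p a * tpow p b <= tpow (p + p) (2^-1 * a + 2^-1 * b).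
Proof.
move=> p0; have [a0|a0] := ltP a 0; first by rewrite tpow_lt0// mul0r tpow_ge0.
have [b0|b0] := ltP b 0; first by rewrite (tpow_lt0 _ b0) mulr0 tpow_ge0.
have m0 : 0 <= 2^-1 * a + 2^-1 * b by rewrite addr_ge0 ?mulr_ge0.
rewrite tpowD// /tpow a0 b0 m0 -!powRM// ge0_ler_powR ?nnegrE ?mulr_ge0//.
rewrite -subr_ge0 (_ : _ - _ = (2^-1 * (a - b)) ^+ 2); last by field.
exact: sqr_ge0.
Qed.

Lemma bary_mid x y k :
  bary (2^-1 *: x + 2^-1 *: y) k = 2^-1 * bary x k + 2^-1 * bary y k.
Proof.
case: (fintype.unliftP ord0 k) => [j|] ->; first by rewrite !baryS !mxE.
rewrite !bary0; under eq_bigr do rewrite !mxE.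
by rewrite big_split/= -!mulr_sumr; field.
Qed.

(* The weight [w] is log-concave: integrating [w x * w y <= w ((x + y) / 2) ^ 2] in [y]
   bounds its supremum by the ratio of the integrals of [w ^ 2] and [w]. *)
Lemma dweight_le p x : (forall k, 0 <= p k) ->
  dweight p x <= 2 ^+ d * dmass (fun k => p k + p k) / dmass p.
Proof.
move=> p0; rewrite (ler_pdivlMr _ _ (dmass_gt0 p0)).
have pp k : 0 <= p k + p k by rewrite addr_ge0.
have mE q : measurable_fun setT (fun v => (dweight q v)%:E).
  by apply/measurable_EFinP; exact: measurable_dweight.
have h0 q v : (0 <= (dweight q v)%:E)%E by rewrite lee_fin dweight_ge0.
have i20 : 0 < 2^-1 :> R by rewrite invr_gt0.
have := ge0_integral_rV_affine (2^-1 *: x) i20 (mE (fun k => p k + p k)) (h0 _).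
rewrite (integral_dweight pp) => h.
rewrite -lee_fin EFinM -(integral_dweight p0).
rewrite -(ge0_integralZl mu measurableT (mE p)); last 2 first.
- by move=> v _.
- exact: h0.
rewrite EFinM h muleA -EFinM exprVn mulfV ?mul1e; last by rewrite expf_neq0.
apply: ge0_le_integral => //.
- by move=> v _; rewrite mule_ge0.
- exact: measurable_funeM.
- by apply: (measurableT_comp (mE _)); exact: measurable_rV_affine.
- move=> v _; rewrite lee_fin /dweight -big_split/=; apply: ler_prod => k _.
  by rewrite mulr_ge0 ?tpow_ge0//= bary_mid tpow_mid.
Qed.

End dirichlet_weight.

(** * Mean value bound for a product of powers *)

Section dirichlet_lipschitz.
Context {R : realType}.

(** The mean value theorem on the segment from [a] to [a + c]: the k-th partial derivative is [p k]
    times the product with the k-th exponent lowered by one, which [M k] bounds inside the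
    segment. *)
Lemma prod_tpow_lipschitz (n : nat) (p a c M : 'I_n -> R) :
  (forall k, 0 < p k) -> (forall k, 0 <= a k) -> (forall k, 0 <= a k + c k) ->
  (forall (t : R) k, 0 < t < 1 ->
    \prod_i tpow (p i - (i == k)%:R) (a i + t * c i) <= M k) ->
  `|\prod_k tpow (p k) (a k + c k) - \prod_k tpow (p k) (a k)| <=
    \sum_k p k * M k * `|c k|.
Proof.
move=> p0 a0 ac0 hM.
have M0 k : 0 <= M k.
  apply: le_trans (hM 2^-1 k _); first by apply: prodr_ge0 => i _; exact: tpow_ge0.
  by lra.
(* A base that is zero at both ends makes both products vanish. Otherwise every base is positive
   strictly inside the segment. *)
have [/existsP[k /andP[/eqP ak /eqP ck]]|/existsPn H] :=
    boolP [exists k, (a k == 0) && (c k == 0)].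
  rewrite (bigD1 k)//= (bigD1 k (F := fun k => tpow (p k) (a k)))//= ak ck addr0.
  rewrite tpow0// !mul0r subrr normr0.
  by apply: sumr_ge0 => i _; rewrite !mulr_ge0// ltW.
have pos (t : R) k : 0 < t < 1 -> 0 < a k + t * c k.
  move=> /andP[t0 t1]; have := H k; have := a0 k; have := ac0 k.
  rewrite negb_and => h1 h2 h3.
  have : 0 < a k \/ 0 < a k + c k.
    move: h2; rewrite le_eqVlt => /orP[/eqP e|]; last by left.
    right; rewrite lt_neqAle h1 andbT -e add0r eq_sym.
    by move: h3; rewrite -e eqxx.
  by case => h; nra.
(* Inside, [h] is the exponential of [L], with derivative [h * dL]; at the ends, where a base may be
   zero, only continuity is asked for. *)
pose h t := \prod_k tpow (p k) (a k + t * c k).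
pose L t := \sum_k p k * ln (a k + t * c k).
pose dL t := \sum_k p k * (c k / (a k + t * c k)).
have hL (t : R) : 0 < t < 1 -> h t = expR (L t).
  move=> t01; rewrite /h /L expR_sum; apply: eq_bigr => k _.
  by rewrite /tpow (ltW (pos _ _ t01)) /powR gt_eqF// pos.
have dh (t : R) : t \in `]0, 1[ -> is_derive t 1 h (h t * dL t).
  rewrite in_itv/= => t01.
  apply: (@near_eq_is_derive _ _ _ (expR \o L)).
    have t1 : t \in `]0, 1[ by rewrite in_itv.
    by near=> u; rewrite /= hL//; near: u; apply: near_in_itvoo t1.
  rewrite hL//; apply: is_derive1_comp.
  rewrite (_ : L = \sum_k (fun t => p k * ln (a k + t * c k))); last first.
    by apply/funext => u; rewrite fct_sumE.
  apply: is_derive_sum => k.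
  have dlin : is_derive t (1 : R) (fun t => a k + t * c k) (c k).
    rewrite (_ : (fun t => a k + t * c k) = cst (a k) + (c k \*: id)); last first.
      by apply/funext => u; rewrite /= mulrC.
    have := is_deriveD (is_derive_cst (a k) t 1) (is_deriveZ (c k) (is_derive_id t (1 : R))).
    by rewrite add0r scaler1.
  have dln : is_derive t (1 : R) (@ln R \o (fun t => a k + t * c k)) ((a k + t * c k)^-1 * c k).
    by apply: is_derive1_comp; apply: is_derive1_ln; exact: pos.
  have -> : p k * (c k / (a k + t * c k)) = p k *: ((a k + t * c k)^-1 * c k).
    by rewrite [c k / _]mulrC.
  exact: is_deriveZ.
have ch : {within `[0, 1], continuous h}.
  apply: continuous_subspaceT => t.
  apply: (@continuous_big R 'I_n (@GRing.mul R) 1 xpredT) => [|k _].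
    exact: mul_continuous.
  move=> u; apply: (cvg_comp (fun t => a k + t * c k) (tpow (p k))); last first.
    exact: continuous_tpow.
  by apply: cvgD; [exact: cvg_cst|apply: cvgM; [exact: cvg_id|exact: cvg_cst]].
have [xi + e] := MVT ltr01 dh ch.
rewrite in_itv/= => xi01.
have -> : \prod_k tpow (p k) (a k + c k) - \prod_k tpow (p k) (a k) = h 1 - h 0.
  by rewrite /h; congr (_ - _); apply: eq_bigr => k _; congr tpow; rewrite ?mul1r ?mul0r ?addr0.
rewrite e subr0 mulr1 /dL mulr_sumr.
apply: le_trans (ler_norm_sum _ _ _) _; apply: ler_sum => k _.
have xk := pos _ k xi01.
(* The denominator brought in by the logarithmic derivative lowers the k-th exponent by one. *)
have -> : h xi * (p k * (c k / (a k + xi * c k))) =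
    p k * (\prod_i tpow (p i - (i == k)%:R) (a i + xi * c i)) * c k.
  rewrite /h (bigD1 k)//= [X in _ = _ * X * _](bigD1 k)//= eqxx.
  rewrite (_ : true%:R = 1 :> R)//.
  rewrite [X in _ = _ * (_ * X) * _](eq_bigr (fun i => tpow (p i) (a i + xi * c i))).
    have -> : tpow (p k) (a k + xi * c k) =
        tpow (p k - 1) (a k + xi * c k) * (a k + xi * c k).
      rewrite /tpow (ltW xk) powRB ?(gt_eqF xk) ?implybT// powRr1 ?(ltW xk)//.
      by rewrite divfK// gt_eqF.
    by generalize (\prod_(i < n | i != k) tpow (p i) (a i + xi * c i)) => Q; field; rewrite gt_eqF.
  by move=> i /negPf ->; rewrite subr0.
rewrite !normrM (ger0_norm (ltW (p0 k))) ler_wpM2r// ler_wpM2l ?(ltW (p0 k))//.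
by rewrite ger0_norm ?hM//; apply: prodr_ge0 => i _; exact: tpow_ge0.
Unshelve. all: by end_near. Qed.
End dirichlet_lipschitz.

Lemma Rintegral_sum (disp : measure_display) (T : measurableType disp)
    (R : realType) (mu : {measure set T -> \bar R}) (D : set T) (n : nat)
    (f : 'I_n -> T -> R) :
  measurable D -> (forall i, mu.-integrable D (EFin \o f i)) ->
  \int[mu]_(x in D) (\sum_i f i x) = \sum_i \int[mu]_(x in D) f i x.
Proof.
move=> mD fi; rewrite /Rintegral sum_fine/=; last first.
  by move=> i _; apply: integrable_fin_num => //; exact: fi.
rewrite -integral_sum//; congr fine.
by apply: eq_integral => x _; rewrite sumEFin.
Qed.

(** * Dirichlet densities: Lipschitz constant, square integral, concentration *)

Section dirichlet_kernel_bounds.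
Context {R : realType} {d : nat}.
Implicit Types (p : 'I_d.+1 -> R) (x y : 'rV[R]_d) (k : 'I_d.+1).
Notation mu := (@lebesgue_rV R d).

Definition dpdf p x : R := dweight p x / dmass p.

(** The integral of the squared density ([Rintegral_dpdf2]), in closed form: squaring a weight
    doubles its exponents. *)
Definition dpdf2 p : R := dmass (fun k => p k + p k) / dmass p ^+ 2.

Lemma dpdf_ge0 p x : (forall k, 0 <= p k) -> 0 <= dpdf p x.
Proof. by move=> p0; rewrite divr_ge0 ?dweight_ge0// ltW// dmass_gt0. Qed.

Lemma dpdf2_gt0 p : (forall k, 0 <= p k) -> 0 < dpdf2 p.
Proof.
move=> p0; apply: divr_gt0; last by rewrite exprn_gt0// dmass_gt0.
by apply: dmass_gt0 => k; rewrite addr_ge0.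
Qed.

Lemma bary_affine x y (t : R) k :
  bary (y + t *: (x - y)) k = bary y k + t * (bary x k - bary y k).
Proof.
case: (fintype.unliftP ord0 k) => [j|] ->; first by rewrite !baryS !mxE.
rewrite !bary0; under eq_bigr do rewrite !mxE.
by rewrite big_split/= -mulr_sumr sumrB; ring.
Qed.

Lemma bary_dist x y (e : R) k : (forall j, `|x 0 j - y 0 j| <= e) ->
  `|bary x k - bary y k| <= d%:R * e.
Proof.
move=> he; case: (fintype.unliftP ord0 k) => [j|] ->.
  rewrite !baryS; apply: le_trans (he j) _.
  have e0 : 0 <= e by apply: le_trans (normr_ge0 _) (he j).
  by rewrite ler_peMl// ler1n; case: (d) j => // -[].
rewrite !bary0 (_ : _ - _ = - \sum_(j < d) (x 0 j - y 0 j)); last first.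
  by rewrite sumrB; ring.
rewrite normrN; apply: le_trans (ler_norm_sum _ _ _) _.
apply: le_trans (ler_sum _ (fun j _ => he j)) _.
by rewrite sumr_const card_ord mulr_natl.
Qed.

Lemma dmass_pbumpN1 p k : (forall i, 1 <= p i) -> dmass (pbump p k (-1)) =
  dmass p * ((\sum_i p i + d%:R) / p k).
Proof.
move=> p1; have p0 i : 0 <= p i by rewrite (le_trans ler01).
have q0 : forall i, 0 <= pbump p k (-1) i by apply: pbump_ge0 => //; rewrite subr_ge0.
have pk : 0 < p k by rewrite (lt_le_trans ltr01).
have S0 : 0 < \sum_i p i + d%:R.
  by rewrite ltr_wpDr// (bigD1 k)//= ltr_wpDr// sumr_ge0.
have -> : dmass p = dmass (pbump (pbump p k (-1)) k 1).
  congr dmass; apply/funext => i; rewrite /pbump; case: eqP => _; rewrite ?addr0//.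
  by rewrite subrK.
rewrite dmass_pbump1// sum_pbump /pbump eqxx.
have -> : \sum_i p i - 1 + d%:R + 1 = \sum_i p i + d%:R by ring.
rewrite subrK; field; rewrite !gt_eqF//.
Qed.

(** [dweight_le] applied to the lowered exponents, the factor [p k] being the one produced by
    differentiation. Both masses are explicit multiples of those of [p]; beyond the stated bound
    there remain [p k / (2 p k - 1)] and [(2 N + d - 1) / (2 (N + d))], both at most 1 since
    [1 <= p k]. *)
Lemma dweight_slope p k x : (forall i, 1 <= p i) ->
  p k * dweight (pbump p k (-1)) x <= 2 ^+ d * (2 * \sum_i p i + d%:R) * dpdf2 p * dmass p.
Proof.
move=> p1; have p0 i : 0 <= p i by rewrite (le_trans ler01).
have q0 : forall i, 0 <= pbump p k (-1) i by apply: pbump_ge0 => //; rewrite subr_ge0.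
have pk : 0 < p k by rewrite (lt_le_trans ltr01).
set N := \sum_i p i; have N1 : p k <= N by rewrite /N (bigD1 k)//= lerDl sumr_ge0.
have pp1 i : 1 <= p i + p i by have := p1 i; lra.
(* Doubling the lowered exponents lowers the doubled k-th exponent by two, hence two uses of the
   recurrence. *)
have D2 : dmass (fun i => pbump p k (-1) i + pbump p k (-1) i) =
    dmass (fun i => p i + p i) * ((2 * N + d%:R) / (p k + p k)) *
    ((2 * N + d%:R - 1) / (p k + p k - 1)).
  rewrite (_ : (fun i => _) = pbump (pbump (fun i => p i + p i) k (-1)) k (-1)).
    rewrite !dmass_pbumpN1//; last first.
      move=> i; rewrite /pbump; case: eqP => [->|_]; last by rewrite addr0.
      by have := p1 k; lra.
    rewrite sum_pbump /pbump eqxx big_split/= -/N.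
    by rewrite (_ : N + N = 2 * N) 1?addrAC//; ring.
  by apply/funext => i; rewrite /pbump; case: eqP => _; ring.
apply: le_trans (ler_wpM2l (ltW pk) (dweight_le x q0)) _.
rewrite D2 dmass_pbumpN1// -/N /dpdf2.
have := dmass_gt0 p0; have : 0 < dmass (fun i => p i + p i).
  by apply: dmass_gt0 => i; rewrite addr_ge0.
have := p1 k; move: pk N1; have : 0 <= d%:R :> R by [].
have : 0 < 2 ^+ d :> R by rewrite exprn_gt0.
clear.
generalize (p k) N (dmass (fun i => p i + p i)) (dmass p) (d%:R : R) (2 ^+ d : R).
move=> P M D I e E E0 e0 P0 PN P1 D0 I0.
have NP : 0 < M by exact: lt_le_trans PN.
have -> : P * (E * (D * ((2 * M + e) / (P + P)) * ((2 * M + e - 1) / (P + P - 1))) / (I * ((M + e) / P)))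
  = E * (2 * M + e) * (D / I ^+ 2) * I * ((P / (P + P - 1)) * ((2 * M + e - 1) / (2 * (M + e)))).
  field; rewrite !gt_eqF//; lra.
rewrite ler_piMr//.
  have M0 : 0 <= 2 * M + e by lra.
  by rewrite mulr_ge0 ?(ltW I0)// mulr_ge0 ?divr_ge0 ?exprn_ge0 ?(ltW I0) ?(ltW D0)// mulr_ge0// ltW.
rewrite mulr_ile1// ?divr_ge0//; try lra.
- by rewrite ler_pdivrMr; lra.
- by rewrite ler_pdivrMr; lra.
Qed.

(** In the mean value bound the factors [p k] cancel. The constant counts d + 1 barycentric
    coordinates, each of which moves by at most [d e], the slack accumulating the d changes. *)
Lemma dpdf_lipschitz p x y (e : R) : (forall k, 1 <= p k) ->
  (forall k, 0 <= bary x k) -> (forall k, 0 <= bary y k) ->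
  (forall j, `|x 0 j - y 0 j| <= e) ->
  `|dpdf p x - dpdf p y| <=
    (d.+1 * d)%:R * 2 ^+ d * ((2 * \sum_k p k + d%:R) * e) * dpdf2 p.
Proof.
move=> p1 x0 y0 he; have p0 k : 0 < p k by rewrite (lt_le_trans ltr01).
have pge k : 0 <= p k by rewrite ltW.
have I0 := dmass_gt0 pge.
set K := 2 ^+ d * (2 * \sum_i p i + d%:R) * dpdf2 p * dmass p.
have hM (t : R) k : 0 < t < 1 ->
    \prod_i tpow (p i - (i == k)%:R) (bary y i + t * (bary x i - bary y i)) <= K / p k.
  move=> _; rewrite ler_pdivlMr// mulrC.
  apply: le_trans (dweight_slope k (y + t *: (x - y)) p1).
  rewrite ler_wpM2l// le_eqVlt; apply/orP; left; apply/eqP.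
  apply: eq_bigr => i _; rewrite bary_affine /pbump; congr (tpow (_ + _) _).
  by case: eqP => _; rewrite ?oppr0.
have xy k : 0 <= bary y k + (bary x k - bary y k) by rewrite addrC subrK.
have := prod_tpow_lipschitz p0 y0 xy hM.
under eq_bigr do rewrite addrC subrK.
rewrite -/(dweight p x) -/(dweight p y) => h.
rewrite /dpdf -mulrBl normrM normfV (gtr0_norm I0) ler_pdivrMr//.
apply: le_trans h _.
have K0 : 0 <= K.
  rewrite /K mulr_ge0 ?(ltW I0)// mulr_ge0 ?(ltW (dpdf2_gt0 pge))// mulr_ge0//.
  by rewrite addr_ge0// mulr_ge0// sumr_ge0.
apply: (@le_trans _ _ (\sum_(k < d.+1) K * (d%:R * e))).
  apply: ler_sum => k _; rewrite mulrCA divff ?gt_eqF// mulr1 ler_wpM2l//.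
  exact: bary_dist.
rewrite sumr_const card_ord -mulr_natl natrM /K.
by rewrite le_eqVlt; apply/orP; left; apply/eqP; ring.
Qed.

(** Moments are taken about the mode [p k / \sum_i p i] and not the mean, because the mode is
    exactly the evaluation point [bary s k] when [p] is proportional to [bary s]. *)
Lemma integral_dweight_dist2 p k : (forall i, 0 <= p i) -> 0 < \sum_i p i ->
  mu.-integrable setT (EFin \o (fun x => (bary x k - p k / \sum_i p i) ^+ 2 * dweight p x)) /\
  \int[mu]_x ((bary x k - p k / \sum_i p i) ^+ 2 * dweight p x) <=
    (1 + d.+1%:R ^+ 2) / (\sum_i p i + d.+1%:R) * dmass p.
Proof.
move=> p0; set S := \sum_i p i => S0; set s := p k / S.
pose p1 := pbump p k 1; pose p2 := pbump p1 k 1.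
have p10 : forall i, 0 <= p1 i by apply: pbump_ge0 => //; rewrite addr_ge0.
have p20 : forall i, 0 <= p2 i by apply: pbump_ge0 => //; rewrite addr_ge0.
have -> : (fun x => (bary x k - s) ^+ 2 * dweight p x) =
    (fun x => (dweight p2 x + s ^+ 2 * dweight p x) - 2 * s * dweight p1 x).
  by apply/funext => x; rewrite /p2 dweight_pbump1// /p1 dweight_pbump1//; ring.
have i1 := integrable_dweight p10; have i2 := integrable_dweight p20.
have i0 := integrable_dweight p0.
have i0' := integrableZl measurableT (s ^+ 2) i0.
have i1' := integrableZl measurableT (2 * s) i1.
have i02 := integrableD measurableT i2 i0'.
split; first exact: (integrableB measurableT i02 i1').
rewrite (RintegralB measurableT i02 i1') (RintegralD measurableT i2 i0').
rewrite (RintegralZl (s ^+ 2) measurableT i0) (RintegralZl (2 * s) measurableT i1).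
rewrite /Rintegral !integral_dweight//= /p2 dmass_pbump1// /p1 dmass_pbump1//.
rewrite sum_pbump -/S /pbump eqxx.
have pS : p k <= S by rewrite /S (bigD1 k)//= lerDl sumr_ge0.
have := dmass_gt0 p0; have := p0 k; rewrite /s; clearbody S; move: S0 pS; clear.
have : 0 <= d%:R :> R by [].
have -> : d.+1%:R = d%:R + 1 :> R by rewrite -natr1.
generalize (p k) (dmass p) (d%:R : R); move=> P I e e0 S0 PS P0 I0.
set T := S + e + 1.
have T0 : 0 < T by rewrite /T; lra.
pose X := (P + 1) / T; pose s := P / S.
have X0 : 0 <= X by rewrite /X divr_ge0; lra.
have X1 : X <= 1 by rewrite /X ler_pdivrMr// mul1r /T; lra.
(* Variance plus squared bias: [X] is the mean of the coordinate and [s] here is the mode. The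
   variance is at most 1/T, and the bias at most (d + 1)/T. *)
have -> : I * ((P + 1) / (S + e + 1)) * ((P + 1 + 1) / (S + 1 + e + 1)) +
    (P / S) ^+ 2 * I - 2 * (P / S) * (I * ((P + 1) / (S + e + 1))) =
    (X * (1 - X) / (T + 1) + (X - s) ^+ 2) * I.
  by rewrite /X /s /T; field; rewrite !gt_eqF//; lra.
rewrite ler_wpM2r ?(ltW I0)// [S + _]addrA -/T mulrDl mul1r.
have T1 : 1 <= T by rewrite /T; lra.
apply: lerD.
  apply: (@le_trans _ _ (T + 1)^-1); last by rewrite lef_pV2 ?posrE; lra.
  by rewrite -[leRHS]mul1r ler_wpM2r ?invr_ge0; nra.
have -> : X - s = (S - P * (e + 1)) / S / T.
  by rewrite /X /s /T; field; rewrite !gt_eqF//; lra.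
have b : `|(S - P * (e + 1)) / S| <= e + 1.
  rewrite normrM normfV (gtr0_norm S0) ler_pdivrMr// ler_norml; apply/andP; split; nra.
rewrite expr_div_n [T ^+ 2]expr2 invfM mulrA ler_wpM2r ?invr_ge0 ?(ltW T0)//.
rewrite -real_normK ?num_real// -[leRHS]mulr1.
by rewrite ler_pM ?invr_ge0 ?sqr_ge0 ?(ltW T0) ?lerXn2r ?nnegrE ?invf_le1//; lra.
Qed.

Lemma dpdf_sqr p x : (forall i, 0 <= p i) ->
  dpdf p x ^+ 2 = dweight (fun k => p k + p k) x / dmass p ^+ 2.
Proof. by move=> p0; rewrite dweightD// /dpdf; field; rewrite gt_eqF// dmass_gt0. Qed.

Lemma integrable_dpdf p : (forall i, 0 <= p i) -> mu.-integrable setT (EFin \o dpdf p).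
Proof.
move=> p0; rewrite (_ : _ \o _ = (fun x => ((dmass p)^-1)%:E * (EFin \o dweight p) x)%E).
  by apply: integrableZl => //; exact: integrable_dweight.
by apply/funext => x; rewrite /= -EFinM mulrC.
Qed.

Lemma Rintegral_dpdf p : (forall i, 0 <= p i) -> \int[mu]_x dpdf p x = 1.
Proof.
move=> p0; rewrite /dpdf; under eq_Rintegral do rewrite mulrC.
rewrite (RintegralZl _ measurableT (integrable_dweight p0)).
by rewrite /Rintegral integral_dweight//= mulVf// gt_eqF// dmass_gt0.
Qed.

Lemma integrable_dpdf2 p : (forall i, 0 <= p i) ->
  mu.-integrable setT (EFin \o (fun x => dpdf p x ^+ 2)).
Proof.
move=> p0; have pp i : 0 <= p i + p i by rewrite addr_ge0.
rewrite (_ : _ \o _ = (fun x => ((dmass p ^+ 2)^-1)%:E *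
   (EFin \o dweight (fun k => p k + p k)%R) x)%E).
  by apply: integrableZl => //; exact: integrable_dweight.
by apply/funext => x; rewrite /= dpdf_sqr// -EFinM mulrC.
Qed.

Lemma Rintegral_dpdf2 p : (forall i, 0 <= p i) -> \int[mu]_x (dpdf p x ^+ 2) = dpdf2 p.
Proof.
move=> p0; have pp i : 0 <= p i + p i by rewrite addr_ge0.
under eq_Rintegral do rewrite (dpdf_sqr _ p0) mulrC.
rewrite (RintegralZl _ measurableT (integrable_dweight pp)).
by rewrite /Rintegral integral_dweight//= mulrC.
Qed.

(** Absolute deviations are controlled by second moments through [|u| <= e + u ^ 2 / e]. The
    parameter [e] is left free; the choice [sqrt b] later balances the two terms. *)
Lemma dpdf2_deviation p (e : R) : (forall i, 0 < p i) -> 0 < e ->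
  let dev x := (\sum_k `|bary x k - p k / \sum_i p i|) * dpdf p x ^+ 2 in
  mu.-integrable setT (EFin \o dev) /\
  \int[mu]_x dev x <= d.+1%:R * (e + e^-1 *
    ((1 + d.+1%:R ^+ 2) / (2 * \sum_i p i + d.+1%:R))) * dpdf2 p.
Proof.
move=> p0 e0 dev; have pge i : 0 <= p i by rewrite ltW.
have pp i : 0 <= p i + p i by rewrite addr_ge0.
set S := \sum_i p i.
have S0 : 0 < S by rewrite /S (bigD1 ord0)//= ltr_wpDr// sumr_ge0.
(* The squared density has doubled exponents, and doubling does not move the mode. *)
pose P := fun i => p i + p i.
have SP : \sum_i P i = 2 * S by rewrite big_split/= -/S; ring.
have SP0 : 0 < \sum_i P i by rewrite SP mulr_gt0.
have I0 := dmass_gt0 pge.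
pose D k x := (bary x k - P k / \sum_i P i) ^+ 2 * dweight P x.
have iD k : mu.-integrable setT (EFin \o D k) := (integral_dweight_dist2 k pp SP0).1.
have leD k := (integral_dweight_dist2 k pp SP0).2.
have mdev : measurable_fun setT (EFin \o dev).
  apply/measurable_EFinP; apply: measurable_funM.
    apply: measurable_sum => k; apply: (measurableT_comp (@normr_measurable _ _)).
    by apply: measurable_funB => //; exact: measurable_bary.
  apply: measurable_funX; apply: measurable_funM => //; exact: measurable_dweight.
pose F x := \sum_k (e * dpdf p x ^+ 2 + e^-1 * (dmass p ^+ 2)^-1 * D k x).
have iF k : mu.-integrable setT
    (EFin \o (fun x => e * dpdf p x ^+ 2 + e^-1 * (dmass p ^+ 2)^-1 * D k x)).
  have i1 := integrableZl measurableT e (integrable_dpdf2 pge).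
  have i2 := integrableZl measurableT (e^-1 * (dmass p ^+ 2)^-1) (iD k).
  exact: (integrableD measurableT i1 i2).
have iFT : mu.-integrable setT (EFin \o F).
  rewrite (_ : _ \o _ = (fun x => \sum_k
    (EFin \o (fun x => e * dpdf p x ^+ 2 + e^-1 * (dmass p ^+ 2)^-1 * D k x)%R) x)%E).
    by apply: integrable_sum => // k _; exact: iF.
  by apply/funext => x; rewrite /F/= sumEFin.
have dev0 x : 0 <= dev x by rewrite mulr_ge0 ?sqr_ge0// sumr_ge0.
have devF x : dev x <= F x.
  rewrite /dev /F mulr_suml; apply: ler_sum => k _.
  rewrite (_ : e^-1 * _ * D k x = e^-1 * (bary x k - p k / S) ^+ 2 * dpdf p x ^+ 2); last first.
    have -> : D k x = (bary x k - p k / S) ^+ 2 * dweight P x.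
      rewrite /D SP; congr ((_ - _) ^+ 2 * _); rewrite /P; field.
      by rewrite gt_eqF.
    by rewrite dpdf_sqr//; ring.
  rewrite -mulrDl ler_wpM2r ?sqr_ge0//.
  set u := bary x k - _.
  rewrite -[u ^+ 2]real_normK ?num_real//; set v := `|u|.
  have sq := sqr_ge0 (v - e).
  rewrite (_ : e + _ = e^-1 * (e ^+ 2 + v ^+ 2)); last by field; rewrite gt_eqF.
  rewrite -(ler_pM2l e0) mulrA divff ?gt_eqF// mul1r.
  by have := normr_ge0 u; rewrite -/v => v0; nra.
have idev : mu.-integrable setT (EFin \o dev).
  apply: (le_integrable measurableT mdev _ iFT) => x _.
  by rewrite /= lee_fin !ger0_norm// (le_trans (dev0 x)).
split => //.
apply: (@le_trans _ _ (\int[mu]_x F x)); first exact: le_Rintegral.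
rewrite /F Rintegral_sum//.
apply: (@le_trans _ _ (\sum_(k < d.+1) ((e + e^-1 *
    ((1 + d.+1%:R ^+ 2) / (2 * S + d.+1%:R))) * dpdf2 p))); last first.
  by rewrite sumr_const card_ord -[leLHS]mulr_natl -[leRHS]mulrA.
apply: ler_sum => k _.
have i1 := integrableZl measurableT e (integrable_dpdf2 pge).
have i2 := integrableZl measurableT (e^-1 * (dmass p ^+ 2)^-1) (iD k).
rewrite (RintegralD measurableT i1 i2).
rewrite (RintegralZl _ measurableT (integrable_dpdf2 pge)) (RintegralZl _ measurableT (iD k)).
rewrite Rintegral_dpdf2// mulrDl lerD2l.
rewrite -[leLHS]mulrA -[leRHS]mulrA ler_wpM2l ?invr_ge0 ?(ltW e0)//.
rewrite /dpdf2 mulrA ler_pdivlMr ?exprn_gt0// mulrAC mulVf ?mul1r ?gt_eqF ?exprn_gt0//.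
by rewrite -SP; exact: leD.
Qed.
End dirichlet_kernel_bounds.

(** * Riemann sums over the cells *)

Section tiling.
Context {R : realType} {d : nat}.
Notation mu := (@lebesgue_rV R d).

(** Cells meet only along their boundaries, which are null: off these, a point of [A] lies in
    exactly one cell, and both sides vanish outside [A]. *)
Lemma Rintegral_tiling (n : nat) (B : 'I_n -> set 'rV[R]_d) (A : set 'rV[R]_d)
    (h : 'rV[R]_d -> R) :
  (forall i, compact (B i)) -> (forall i, B i `<=` A) ->
  (forall i j, i != j -> (B i)° `&` (B j)° = set0) ->
  \bigcup_(i in [set: 'I_n]) B i = A ->
  (forall i, mu (boundary (B i)) = 0%E) ->
  mu.-integrable setT (EFin \o h) -> (forall x, ~ A x -> h x = 0) ->
  \int[mu]_x h x = \sum_i \int[mu]_(x in B i) h x.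
Proof.
move=> cB BA dB UB nB ih h0.
have clB i : closed (B i) by apply: compact_closed => //; exact: norm_hausdorff.
have mB i : measurable (B i).
  by rewrite -[B i]setCK; apply: measurableC; apply: open_measurable_rV; rewrite openC.
have ihB i : mu.-integrable setT (EFin \o (h \_ (B i))).
  rewrite -restrict_EFin; apply/integrable_restrict => //.
  by rewrite setTI; apply: integrableS ih.
under [RHS]eq_bigr do rewrite Rintegral_mkcond.
rewrite -Rintegral_sum//.
congr fine; apply: ae_eq_integral => //.
- by case/integrableP : ih.
- rewrite (_ : (fun x => _) = (fun x => \sum_i (EFin \o (h \_ (B i))) x)%E).
    by apply: emeasurable_sum => i; exact: (measurable_int _ (ihB i)).
  by apply/funext => x; rewrite sumEFin.
have aeB : {ae mu, forall x, forall i, ~ boundary (B i) x}.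
  apply: filter_forall => i; exists (boundary (B i)); split => //.
    rewrite /boundary; apply: measurableD; last first.
      by apply: open_measurable_rV; exact: open_interior.
    by rewrite -((closure_id _).1 (clB i)); exact: mB.
  by move=> x /= /contrapT.
apply: filterS aeB => x nx _.
  have nbd i : B i x -> (B i)° x.
    move=> Bx; apply: contrapT => nix; apply: (nx i).
    by split => //; exact: subset_closure.
  congr EFin.
  have [Ax|nAx] := pselect (A x); last first.
    rewrite h0// big1// => i _; rewrite patchE.
    by case: ifPn => // /set_mem /BA.
  have [i _ Bi] : (\bigcup_(i in [set: 'I_n]) B i) x by rewrite UB.
  rewrite (bigD1 i)//= patchE mem_set// big1 ?addr0// => j ji.
  rewrite patchE; case: ifPn => // /set_mem Bj.
  have : ((B j)° `&` (B i)°) x by split; exact: nbd.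
  by rewrite dB.
Qed.

Lemma integrable_cst_in (B : set 'rV[R]_d) (c : R) :
  measurable B -> (mu B < +oo)%E -> mu.-integrable B (fun=> c%:E).
Proof.
move=> mB Boo; apply/integrableP; split => //=.
by rewrite integral_cst// lte_mul_pinfty// ge0_fin_numE.
Qed.

(** With [k] the integral of [K] and [L] the volume of [B], the difference is the integral of
    [K (k - L K)], and [k - L K(x)] integrates [K(y) - K(x)] over [y] in [B], so it is at most
    [L e]. *)
Lemma sqr_Rintegral_dev (B : set 'rV[R]_d) (K : 'rV[R]_d -> R) (e : R) :
  measurable B -> (mu B < +oo)%E ->
  mu.-integrable setT (EFin \o K) -> mu.-integrable setT (EFin \o (fun x => K x ^+ 2)) ->
  (forall x, 0 <= K x) -> (forall x y, B x -> B y -> `|K x - K y| <= e) ->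
  `|(\int[mu]_(x in B) K x) ^+ 2 - fine (mu B) * \int[mu]_(x in B) (K x ^+ 2)| <=
    fine (mu B) * e * \int[mu]_(x in B) K x.
Proof.
move=> mB Boo iK iK2 K0 hK.
set k := \int[mu]_(x in B) K x; set L := fine (mu B).
have iKB : mu.-integrable B (EFin \o K) by apply: integrableS iK.
have iK2B : mu.-integrable B (EFin \o (fun x => K x ^+ 2)) by apply: integrableS iK2.
have ic (c : R) : mu.-integrable B (fun=> c%:E) by exact: integrable_cst_in.
have L0 : 0 <= L by rewrite fine_ge0.
have hk x : B x -> `|k - L * K x| <= L * e.
  move=> Bx.
  have -> : L * K x = \int[mu]_(y in B) K x by rewrite Rintegral_cst// mulrC.
  rewrite -RintegralB//; last exact: (ic (K x)).
  apply: le_trans (le_normr_Rintegral _ _) _ => //.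
    exact: (integrableB mB iKB (ic (K x))).
  have -> : L * e = \int[mu]_(y in B) e by rewrite Rintegral_cst// mulrC.
  apply: le_Rintegral => //.
  - by apply: integrable_norm; exact: (integrableB mB iKB (ic (K x))).
  - exact: (ic e).
  - by move=> y By; apply: hK.
have i1 : mu.-integrable B (EFin \o (fun x => K x * k)).
  exact: (integrableZr mB k iKB).
have i2 : mu.-integrable B (EFin \o (fun x => L * K x ^+ 2)).
  exact: (integrableZl mB L iK2B).
have i12 := integrableB mB i1 i2.
have E : (fun x => K x * (k - L * K x)) = (fun x => K x * k - L * K x ^+ 2).
  by apply: funext => y /=; ring.
have iE : mu.-integrable B (EFin \o (fun x => K x * (k - L * K x))).
  by rewrite E; exact: i12.
rewrite (_ : k ^+ 2 - _ = \int[mu]_(x in B) (K x * (k - L * K x))); last first.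
  by rewrite E RintegralB// RintegralZl// RintegralZr// -/k expr2.
apply: (@le_trans _ _ (\int[mu]_(x in B) `|K x * (k - L * K x)|)).
  exact: le_normr_Rintegral.
rewrite -RintegralZl//; apply: le_Rintegral => //.
- exact: (integrable_norm iE).
- exact: (integrableZl mB (L * e) iKB).
- by move=> x Bx; rewrite normrM (ger0_norm (K0 x)) mulrC ler_wpM2r// hk.
Qed.

End tiling.

(** The three replacements in abstract form. On cell i, [k], [v], [w] are the integrals of K, of K^2
    and of K^2 times the distance to s; [L] is the volume, [sg] the variance, [gi] and [gs] are
    sigma^2/f at the design point and at s. The error is split into one summand per replacement. *)
Lemma weighted_sum_bound (R : realFieldType) (n : nat)
    (k v w L sg gi : 'I_n -> R) (N S La th eta l de gs A W : R) :
  0 < N -> (forall i, `|k i ^+ 2 - L i * v i| <= L i * eta * k i) ->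
  (forall i, 0 <= sg i <= S) -> (forall i, `|sg i * L i - gi i / N| <= S * th / N) ->
  (forall i, 0 <= L i <= La / N) -> (forall i, `|gi i - gs| * v i <= l * (de * v i + w i)) ->
  0 <= eta -> (forall i, 0 <= k i) -> (forall i, 0 <= v i) ->
  \sum_i k i = 1 -> \sum_i v i = A -> \sum_i w i = W ->
  `|N * \sum_i sg i * k i ^+ 2 - gs * A| <= S * La * eta + S * th * A + l * (de * A + W).
Proof.
move=> N0 h1 h2 h3 h4 h5 eta0 k0 v0 e1 <- <-.
have -> : N * \sum_i sg i * k i ^+ 2 - gs * \sum_i v i =
    \sum_i (N * sg i * (k i ^+ 2 - L i * v i) + N * (sg i * L i - gi i / N) * v i + (gi i - gs) * v i).
  rewrite !mulr_sumr -sumrB; apply: eq_bigr => i _; field.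
  by rewrite gt_eqF.
apply: (@le_trans _ _ (\sum_i (S * La * eta * k i + S * th * v i + l * (de * v i + w i)))).
  apply: le_trans (ler_norm_sum _ _ _) _; apply: ler_sum => i _.
  have /andP[s0 sS] := h2 i; have /andP[L0 LLa] := h4 i.
  have S0 : 0 <= S by exact: le_trans sS.
  apply: le_trans (ler_normD _ _) _; apply: lerD.
    apply: le_trans (ler_normD _ _) _; apply: lerD.
      rewrite normrM normrM (gtr0_norm N0) (ger0_norm s0).
      apply: (@le_trans _ _ (N * S * (La / N * eta * k i))); last first.
        rewrite le_eqVlt; apply/orP; left; apply/eqP; field; rewrite gt_eqF//.
      apply: ler_pM; rewrite ?mulr_ge0 ?(ltW N0)//; first by rewrite ler_pM2l.
      apply: le_trans (h1 i) _.
      by rewrite ler_wpM2r// ler_wpM2r.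
    rewrite 2!normrM (gtr0_norm N0) (ger0_norm (v0 i)) ler_wpM2r//.
    apply: (@le_trans _ _ (N * (S * th / N))); first by rewrite ler_pM2l.
    rewrite le_eqVlt; apply/orP; left; apply/eqP; field; rewrite gt_eqF//.
  by rewrite normrM (ger0_norm (v0 i)).
rewrite !big_split/= -!mulr_sumr e1 mulr1 !big_split/= -!mulr_sumr.
by rewrite le_eqVlt; apply/orP; left; apply/eqP; ring.
Qed.

(** * Variance of independent sums *)

Section independence.
Context {disp : measure_display} {T : measurableType disp} {R : realType}.
Variable P : probability T R.

(** The joint law agrees with the product of the marginal laws on rectangles, hence everywhere;
    Fubini then factors the integral of the coordinate product. *)
Lemma indep_integralM (X Y : {RV P >-> R}) :
  (forall A B : set R, measurable A -> measurable B ->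
    (P ((X @^-1` A) `&` (Y @^-1` B)) = P (X @^-1` A) * P (Y @^-1` B))%E) ->
  P.-integrable setT (EFin \o X) -> P.-integrable setT (EFin \o Y) ->
  P.-integrable setT (EFin \o (fun w => X w * Y w)) ->
  (\int[P]_w (X w * Y w)%:E = \int[P]_w (X w)%:E * \int[P]_w (Y w)%:E)%E.
Proof.
move=> indep iX iY iXY.
pose phi w : R * R := (X w, Y w).
have mphi : measurable_fun setT phi by apply: measurable_fun_pair.
pose f (z : R * R) := (z.1 * z.2)%:E.
have mf : measurable_fun setT f.
  by apply/measurable_EFinP; apply: measurable_funM.
have muE A : measurable A ->
    (distribution P X \x distribution P Y)%E A = pushforward P phi A.
  move=> mA; apply: product_measure_unique => // C D mC mD.
have intE (h : _ -> \bar R) : (\int[distribution P X \x distribution P Y]_z h z =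
    \int[pushforward P phi]_z h z)%E.
  by apply: eq_measure_integral => // A mA _; exact: muE.
have iprod : (distribution P X \x distribution P Y)%E.-integrable setT f.
  apply/integrableP; split => //.
  rewrite intE; have := integrable_pushforward mphi mf iXY measurableT.
  by case/integrableP.
transitivity (\int[distribution P X \x distribution P Y]_z f z)%E.
  by rewrite intE integral_pushforward.
rewrite -integral12_prod_meas1// /fubini_F/=.
have iYd : (distribution P Y).-integrable setT (EFin \o (@idfun R)).
  exact: (integrable_pushforward (measurable_funP Y) _ iY measurableT).
transitivity (\int[distribution P X]_x (x%:E * \int[P]_w (Y w)%:E))%E.
  apply: eq_integral => x _; rewrite /f/=.
  transitivity (\int[distribution P Y]_y (x%:E * y%:E))%E; first exact: eq_integral.
  rewrite integralZl//; congr (_ * _)%E.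
  by rewrite integral_distribution.
have := integrable_fin_num measurableT iY => /fineK <-.
rewrite integralZr//; last first.
  exact: (integrable_pushforward (measurable_funP X) _ iX measurableT).
by congr (_ * _)%E; rewrite integral_distribution.
Qed.

(** Centring leaves [\sum_i w i * eps i]; in its expanded square the off-diagonal integrals vanish
    by independence and zero means. *)
Lemma variance_indep_sum (n : nat) (eps : 'I_n -> {RV P >-> R}) (s2 c w : 'I_n -> R) :
  mutually_independent eps -> (forall i, 'E_P[eps i] = 0)%E ->
  (forall i, 'V_P[eps i] = (s2 i)%:E)%E ->
  ('V_P[(fun omega => \sum_i (c i + eps i omega) * w i)%R] =
   (\sum_i s2 i * w i ^+ 2)%:E)%E.
Proof.
move=> indep E0 Vs.
have int2 i : (\int[P]_t (eps i t * eps i t)%:E = (s2 i)%:E)%E.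
  rewrite -Vs /variance covariance.unlock E0 expectation.unlock; apply: eq_integral => t _.
  by congr EFin; change (eps i t * eps i t = (eps i t - 0) * (eps i t - 0)); rewrite subr0.
have mm i j : measurable_fun setT (fun t => eps i t * eps j t).
  exact: measurable_funM.
have i2 i : P.-integrable setT (EFin \o (fun t => eps i t * eps i t)).
  apply/integrableP; split; first exact/measurable_EFinP.
  under eq_integral => t _ do rewrite /= ger0_norm ?sqr_ge0//.
  by rewrite int2 ltry.
(* Finite second moments give the other integrability facts, through [|u| <= 1 + u ^ 2] and
   [|u v| <= u ^ 2 + v ^ 2]. *)
have i1 i : P.-integrable setT (EFin \o eps i).
  have ic : P.-integrable setT (EFin \o (cst 1 : T -> R)).
    exact: finite_measure_integrable_cst.
  apply: le_integrable (integrableD measurableT ic (i2 i)) => //.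
    exact/measurable_EFinP.
  move=> t _ /=; rewrite lee_fin [leRHS]ger0_norm ?addr_ge0 ?sqr_ge0//.
  by rewrite ler_norml; apply/andP; split; nra.
have iM i j : P.-integrable setT (EFin \o (fun t => eps i t * eps j t)).
  apply: le_integrable (integrableD measurableT (i2 i) (i2 j)) => //.
    exact/measurable_EFinP.
  move=> t _ /=; rewrite lee_fin [leRHS]ger0_norm ?addr_ge0 ?sqr_ge0//.
  by rewrite ler_norml; apply/andP; split; nra.
have int1 i : \int[P]_t eps i t = 0.
  by have := E0 i; rewrite unlock /Rintegral => ->.
have intM i j : \int[P]_t (eps i t * eps j t) = if i == j then s2 i else 0.
  case: eqP => [<-|/eqP ij]; first by rewrite /Rintegral int2.
  rewrite /Rintegral indep_integralM//.
    by have := E0 i; rewrite unlock => ->; rewrite mul0e.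
  move=> A B mA mB.
  have := indep [set i; j]%SET (fun k => if k == i then A else B).
  rewrite (_ : \bigcap_(k in _) _ = (eps i @^-1` A) `&` (eps j @^-1` B)).
    rewrite big_setU1 ?inE// big_set1 eqxx eq_sym (negbTE ij); apply.
    by move=> k; case: ifP.
  apply/seteqP; split => t /=.
    move=> h; split; have := h i; have := h j; rewrite /= !inE !eqxx orbT/=.
      by move=> _; exact.
    by rewrite eq_sym (negbTE ij) => + _; exact.
  move=> [Ai Bj] k; rewrite /= !inE => /orP[] /eqP ->; rewrite ?eqxx//.
  by rewrite eq_sym (negbTE ij).
pose X t := \sum_i (c i + eps i t) * w i.
have iX i : P.-integrable setT (EFin \o (fun t => (c i + eps i t) * w i)).
  have ic : P.-integrable setT (EFin \o (cst (c i) : T -> R)).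
    exact: finite_measure_integrable_cst.
  exact: (integrableZr measurableT (w i) (integrableD measurableT ic (i1 i))).
have EX : fine (expectation P X) = \sum_i c i * w i.
  rewrite expectation.unlock -/(Rintegral _ _ _) Rintegral_sum//.
  apply: eq_bigr => i _.
  have ic : P.-integrable setT (EFin \o (cst (c i) : T -> R)).
    exact: finite_measure_integrable_cst.
  rewrite RintegralZr//; last exact: (integrableD measurableT ic (i1 i)).
  have PT : fine (P setT) = 1 by rewrite (@probability_setT _ _ _ P).
  by rewrite RintegralD// int1 addr0 Rintegral_cst// PT mulr1.
rewrite /variance covariance.unlock -/X EX expectation.unlock.
transitivity (\int[P]_t (\sum_i \sum_j w i * w j * (eps i t * eps j t))%:E)%E.
  apply: eq_integral => t _; congr EFin.
  rewrite [LHS](_ : _ = (\sum_i w i * eps i t) * (\sum_j w j * eps j t)).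
    rewrite mulr_suml; apply: eq_bigr => i _; rewrite mulr_sumr.
    by apply: eq_bigr => j _; ring.
  suff e : X t - \sum_i c i * w i = \sum_i w i * eps i t.
    by change ((X t - \sum_i c i * w i) * (X t - \sum_i c i * w i) =
      (\sum_i w i * eps i t) * (\sum_j w j * eps j t)); rewrite e.
  by rewrite /X -sumrB; apply: eq_bigr => i _; ring.
have iwM i j : P.-integrable setT (EFin \o (fun t => w i * w j * (eps i t * eps j t))).
  exact: (integrableZl measurableT (w i * w j) (iM i j)).
have iwS i : P.-integrable setT (EFin \o (fun t => \sum_j w i * w j * (eps i t * eps j t))).
  rewrite (_ : _ \o _ = (fun t => \sum_j
    (EFin \o (fun t => w i * w j * (eps i t * eps j t))%R) t)%E).
    by apply: integrable_sum => // j _; exact: iwM.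
  by apply/funext => t; rewrite /= sumEFin.
have iwT : P.-integrable setT
    (EFin \o (fun t => \sum_i \sum_j w i * w j * (eps i t * eps j t))).
  rewrite (_ : _ \o _ = (fun t => \sum_i
    (EFin \o (fun t => \sum_j w i * w j * (eps i t * eps j t))%R) t)%E).
    by apply: integrable_sum => // i _; exact: iwS.
  by apply/funext => t; rewrite /= sumEFin.
rewrite -(fineK (integrable_fin_num measurableT iwT)).
congr EFin; rewrite -/(Rintegral _ _ _) Rintegral_sum//.
apply: eq_bigr => i _; rewrite Rintegral_sum//.
rewrite (bigD1 i)//= big1 ?addr0.
  by rewrite RintegralZl// intM eqxx; ring.
by move=> j ji; rewrite RintegralZl// intM eq_sym (negbTE ji) mulr0.
Qed.

End independence.

(** * The Dirichlet kernel and its asymptotics *)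

Section dirichlet_kernel.
Context {R : realType} {d : nat}.
Implicit Types (s x : 'rV[R]_d) (b : R).

Lemma l1norm_sum s : (forall j, 0 <= s 0 j) -> l1norm s = \sum_(j < d) s 0 j.
Proof. by move=> s0; apply: eq_bigr => j _; rewrite ger0_norm. Qed.

Lemma simplex_bary_ge0 x k : simplex R d x -> 0 <= bary x k.
Proof.
move=> [x0 x1]; have xg j : 0 <= x 0 j by case/andP: (x0 j).
case: (fintype.unliftP ord0 k) => [j|] ->; first by rewrite baryS.
by rewrite bary0 subr_ge0 -l1norm_sum.
Qed.

Lemma simplex_int_bary_gt0 x k : simplex_int R d x -> 0 < bary x k.
Proof.
move=> [x0 x1]; have xg j : 0 < x 0 j by case/andP: (x0 j).
case: (fintype.unliftP ord0 k) => [j|] ->; first by rewrite baryS.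
by rewrite bary0 subr_gt0 -l1norm_sum// => j; exact: ltW.
Qed.

Lemma simplex_int_sub : simplex_int R d `<=` simplex R d.
Proof.
move=> x [x0 x1]; split; last exact: ltW.
by move=> j; have /andP[? ?] := x0 j; rewrite !ltW.
Qed.

Lemma bary_ge0_simplex x : (forall k, 0 <= bary x k) -> simplex R d x.
Proof.
move=> x0; have xg j : 0 <= x 0 j by rewrite -baryS.
have x1 : \sum_j x 0 j <= 1 by rewrite -subr_ge0 -bary0.
split; last by rewrite l1norm_sum.
move=> j; rewrite xg/=; apply: le_trans x1.
by rewrite (bigD1 j)//= lerDl sumr_ge0.
Qed.

(** The kernel's Dirichlet parameters exceed the exponents [bary s k / b] by one. On the simplex all
    bases are nonnegative, so [tpow] is the plain power. *)
Lemma dirichlet_kernelE s x b : simplex_int R d s -> simplex R d x -> 0 < b ->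
  dirichlet_kernel s b x = dpdf (fun k => bary s k / b) x.
Proof.
move=> sS xS b0; have xb k := simplex_bary_ge0 k xS.
have sb k := simplex_int_bary_gt0 k sS.
have sj j : 0 < s 0 j by rewrite -baryS.
have xj j : 0 <= x 0 j by rewrite -baryS.
set p := fun k => bary s k / b.
have pS j : p (lift ord0 j) = s 0 j / b by rewrite /p baryS.
have l1s : l1norm s = \sum_j s 0 j by apply: l1norm_sum => j; exact: ltW.
have p0E : (1 - l1norm s) / b = p ord0 by rewrite /p bary0 l1s.
pose alpha := b^-1 *: s + const_mx 1.
have aS j : alpha 0 j = p (lift ord0 j) + 1 by rewrite pS !mxE mulrC.
rewrite /dirichlet_kernel /dirichlet_density p0E -/alpha.
have -> : Gamma (l1norm alpha + (p ord0 + 1)) = gamma1 (\sum_k p k + d%:R).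
  rewrite -Gamma_gamma1; congr Gamma; rewrite l1norm_sum => [|j]; last first.
    by rewrite aS pS addr_ge0// divr_ge0 ?ltW.
  under eq_bigr do rewrite aS.
  by rewrite big_split/= sumr_const card_ord big_ord_recl; ring.
have -> : \prod_(j < d) Gamma (alpha 0 j) = \prod_(j < d) gamma1 (p (lift ord0 j)).
  by apply: eq_bigr => j _; rewrite aS Gamma_gamma1.
have -> : \prod_(j < d) x 0 j `^ (alpha 0 j - 1) =
    \prod_(j < d) tpow (p (lift ord0 j)) (bary x (lift ord0 j)).
  by apply: eq_bigr => j _; rewrite aS addrK baryS /tpow xj.
rewrite Gamma_gamma1 addrK (l1norm_sum xj) -bary0 /dpdf /dweight /dmass.
rewrite [\prod_k tpow _ _]big_ord_recl.
have -> : \prod_(k < d.+1) gamma1 (p k) = gamma1 (p ord0) * \prod_(j < d) gamma1 (p (lift ord0 j)).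
  by rewrite big_ord_recl.
have -> : tpow (p ord0) (bary x ord0) = bary x ord0 `^ p ord0 by rewrite /tpow xb.
by rewrite invf_div -mulrA mulrC.
Qed.

Lemma gamma1D (z : R) n : 0 <= z -> gamma1 (z + n%:R) = gamma1 z * \prod_(i < n) (z + i.+1%:R).
Proof.
move=> z0; elim: n => [|n IH]; first by rewrite big_ord0 addr0 mulr1.
rewrite big_ord_recr/= mulrA -IH mulrC.
have -> : z + n.+1%:R = z + n%:R + 1 by rewrite -addrA natr1.
by rewrite gamma1S// addr_ge0.
Qed.

(** Each Gamma value at a doubled argument is paired with the square of the one at the simple
    argument. The shift by [d] in the total is undone by [gamma1D], which leaves the rational
    product. *)
Lemma dpdf2E (p : 'I_d.+1 -> R) : (forall k, 0 <= p k) -> let N := \sum_k p k in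
  dpdf2 p = (\prod_k gamma1_ratio (p k)) / gamma1_ratio N *
    \prod_(i < d) ((N + i.+1%:R) ^+ 2 / (2 * N + i.+1%:R)).
Proof.
move=> p0 N; have N0 : 0 <= N by apply: sumr_ge0.
rewrite /dpdf2 /dmass -/N big_split/= -/N (_ : N + N = 2 * N); last by ring.
rewrite !gamma1D ?mulr_ge0// /gamma1_ratio.
have -> : \prod_k (gamma1 (2 * p k) / gamma1 (p k) ^+ 2) =
    (\prod_k gamma1 (p k + p k)) / (\prod_k gamma1 (p k)) ^+ 2.
  by rewrite -prodrXl -prodf_div; apply: eq_bigr => k _; rewrite mulr_natl.
rewrite prodf_div prodrXl.
set x6 := \prod_(k < d.+1) gamma1 (p k + p k); set x1 := \prod_(k < d.+1) gamma1 (p k).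
set x4 := \prod_(i < d) (2 * N + _); set x5 := \prod_(i < d) (N + _).
have h1 : x1 != 0 by rewrite gt_eqF// prodr_gt0// => k _; exact: gamma1_gt0.
have h2 : gamma1 N != 0 by rewrite gt_eqF// gamma1_gt0.
have h3 : gamma1 (2 * N) != 0 by rewrite gt_eqF// gamma1_gt0// mulr_ge0.
have h4 : x4 != 0 by rewrite gt_eqF// prodr_gt0// => i _; rewrite ltr_wpDl ?mulr_ge0.
have h5 : x5 != 0 by rewrite gt_eqF// prodr_gt0// => i _; rewrite ltr_wpDl.
move: h1 h2 h3 h4 h5; move: x1 x4 x5 x6 (gamma1 N) (gamma1 (2 * N)); clear.
move=> x1 x4 x5 x6 x2 x3 h1 h2 h3 h4 h5.
by field; rewrite h1 h2 h3 h4 h5.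
Qed.

Lemma gamma1_ratioE (z : R) : 0 < z -> gamma1_ratio z = gamma1_rho z * 4 `^ z / Num.sqrt (pi * z).
Proof.
move=> z0; rewrite /gamma1_rho.
have h1 : 4 `^ z != 0 :> R by rewrite gt_eqF// powR_gt0.
have h2 : Num.sqrt (pi * z) != 0 by rewrite gt_eqF// sqrtr_gt0 mulr_gt0// pi_gt0.
by rewrite mulfVK// mulfK.
Qed.

Lemma gamma1_rho_gt0 (z : R) : 0 < z -> 0 < gamma1_rho z.
Proof.
move=> z0; rewrite /gamma1_rho mulr_gt0 ?invr_gt0 ?powR_gt0//.
by rewrite mulr_gt0 ?gamma1_ratio_gt0 ?(ltW z0)// sqrtr_gt0 mulr_gt0// pi_gt0.
Qed.

(** An exact identity in which every factor of the bracket has a finite limit: 1 for the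
    [gamma1_rho] and rational factors, a Gamma ratio for each j in [J]. *)
Lemma dpdf2_rescaled (J : {set 'I_d}) s b : simplex_int R d s -> 0 < b ->
  let p k := bary s k / b in
  dpdf2 p * b `^ ((d + #|J|)%:R / 2) = psi J s *
    (gamma1_rho (p ord0) * (\prod_(j in ~: J) gamma1_rho (p (lift ord0 j))) *
     (\prod_(j in J) (gamma1_ratio (p (lift ord0 j)) / (2 * 4 `^ (p (lift ord0 j))))) /
     gamma1_rho b^-1 *
     \prod_(i < d) (2 * b * (b^-1 + i.+1%:R) ^+ 2 / (2 * b^-1 + i.+1%:R))).
Proof.
move=> sS b0 p; have sb k := simplex_int_bary_gt0 k sS.
have p0 k : 0 < p k by rewrite /p divr_gt0.
have sj j : 0 < s 0 j by rewrite -baryS.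
have N0 : 0 < b^-1 by rewrite invr_gt0.
have SN : \sum_k p k = b^-1 by rewrite -mulr_suml sum_bary mul1r.
rewrite dpdf2E => [|k]; last exact: ltW.
have nJ j : (j \notin J) = (j \in ~: J) by rewrite finset.in_setC.
rewrite SN big_ord_recl (bigID (mem J))/= (eq_bigl _ (fun j => gamma1_ratio (p (lift ord0 j))) nJ).
pose s0 := bary s ord0; pose Ps := \prod_(j in ~: J) s 0 j; pose m := #|~: J|.
have Ps0 : 0 < Ps by apply: prodr_gt0.
have Jd : (#|J| + m = d)%N by rewrite /m -[RHS]card_ord cardsC.
have cs : pi > 0 :> R := pi_gt0 _.
have EnJ : \prod_(j in ~: J) gamma1_ratio (p (lift ord0 j)) =
    (\prod_(j in ~: J) gamma1_rho (p (lift ord0 j))) *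
    (\prod_(j in ~: J) 4 `^ (p (lift ord0 j))) / Num.sqrt ((pi / b) ^+ m * Ps).
  have -> : (pi / b) ^+ m * Ps = \prod_(j in ~: J) (pi * p (lift ord0 j)).
    rewrite /Ps -prodr_const -big_split/=; apply: eq_bigr => j _.
    by rewrite /p baryS; field; rewrite gt_eqF.
  have -> : Num.sqrt (\prod_(j in ~: J) (pi * p (lift ord0 j))) =
      \prod_(j in ~: J) Num.sqrt (pi * p (lift ord0 j)).
    suff [] : 0 <= \prod_(j in ~: J) (pi * p (lift ord0 j)) /\
      Num.sqrt (\prod_(j in ~: J) (pi * p (lift ord0 j))) =
      \prod_(j in ~: J) Num.sqrt (pi * p (lift ord0 j)) by [].
    apply: (big_rec2 (fun x y : R => 0 <= x /\ Num.sqrt x = y)).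
      by rewrite sqrtr1.
    move=> j x y _ [x0 <-]; have pj : 0 <= pi * p (lift ord0 j) by rewrite mulr_ge0 ?ltW.
    by rewrite sqrtrM// mulr_ge0.
  rewrite -big_split -prodf_div/=; apply: eq_bigr => j _; exact: gamma1_ratioE.
have pD (x y : R) : 4 `^ (x + y) = 4 `^ x * 4 `^ y :> R.
  by rewrite powRD// (_ : (4 != 0 :> R) = true) ?implybT// pnatr_eq0.
(* The exponents sum to 1/b, so the total's power of 4 splits over the coordinates. *)
have E4 : 4 `^ b^-1 = 4 `^ (p ord0) * ((\prod_(j in J) 4 `^ (p (lift ord0 j))) *
    \prod_(j in ~: J) 4 `^ (p (lift ord0 j))) :> R.
  rewrite -SN big_ord_recl pD; congr (_ * _).
  rewrite (bigID (mem J))/= pD; congr (_ * _).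
    by apply: (big_morph (fun z : R => 4 `^ z)) => [x y|]; rewrite ?powRr0// pD.
  rewrite (eq_bigl _ (fun j => p (lift ord0 j)) nJ).
  by apply: (big_morph (fun z : R => 4 `^ z)) => [x y|]; rewrite ?powRr0// pD.
have EJ : \prod_(j in J) (gamma1_ratio (p (lift ord0 j)) / (2 * 4 `^ (p (lift ord0 j)))) =
    (\prod_(j in J) gamma1_ratio (p (lift ord0 j))) /
    (2 ^+ #|J| * \prod_(j in J) 4 `^ (p (lift ord0 j))).
  by rewrite prodf_div [X in _ / X]big_split/= prodr_const.
have Eb : \prod_(i < d) (2 * b * (b^-1 + i.+1%:R) ^+ 2 / (2 * b^-1 + i.+1%:R)) =
    (2 * b) ^+ d * \prod_(i < d) ((b^-1 + i.+1%:R) ^+ 2 / (2 * b^-1 + i.+1%:R)).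
  under eq_bigr do rewrite -mulrA.
  by rewrite big_split/= prodr_const card_ord.
(* The count of powers of [b]: m/2 from the coordinates outside [J] and (d + |J|)/2 from the
   rescaling add up to d, since |J| + m = d. The power 2^m comes from the factor 4 in [psi]. *)
have key : Num.sqrt (pi * b^-1) / (Num.sqrt (pi * p ord0) * Num.sqrt ((pi / b) ^+ m * Ps)) *
    b `^ ((d + #|J|)%:R / 2) = psi J s * ((2 * b) ^+ d / 2 ^+ #|J|).
  have s00 : 0 < s0 by exact: sb.
  have -> : b `^ ((d + #|J|)%:R / 2) = Num.sqrt (b ^+ (d + #|J|)).
    by rewrite powRrM powR_mulrn ?(ltW b0)// powR12_sqrt// exprn_ge0// ltW.
  have -> : psi J s = (Num.sqrt ((4 * pi) ^+ m * s0 * Ps))^-1.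
    rewrite /psi l1norm_sum => [|j]; last exact: ltW.
    rewrite -bary0 powRN powR12_sqrt -/s0 -/Ps; last first.
      by rewrite !mulr_ge0 ?exprn_ge0 ?mulr_ge0 ?(ltW s00) ?(ltW Ps0) ?(ltW cs).
    have aux (u v w : nat) : (u + v = w -> w - u = v)%N by move=> <-; rewrite addKn.
    by rewrite (aux _ _ _ Jd).
  have pb0 : 0 < pi / b by rewrite divr_gt0.
  have e1 : 0 <= pi * b^-1 by rewrite ltW.
  have e2 : 0 <= pi * p ord0 by rewrite mulr_ge0 ?(ltW cs) ?(ltW (p0 _)).
  have e3 : 0 <= (pi / b) ^+ m * Ps by rewrite mulr_ge0 ?exprn_ge0 ?(ltW pb0) ?(ltW Ps0).
  have e4 : 0 <= b ^+ (d + #|J|) by rewrite exprn_ge0// ltW.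
  have e5 : 0 <= (4 * pi) ^+ m * s0 * Ps.
    by rewrite !mulr_ge0 ?exprn_ge0 ?mulr_ge0 ?(ltW s00) ?(ltW Ps0) ?(ltW cs).
  apply/eqP; rewrite -(@eqrXn2 _ 2)//; last first.
    by rewrite mulr_ge0 ?invr_ge0 ?sqrtr_ge0// divr_ge0 ?exprn_ge0 ?mulr_ge0 ?(ltW b0).
  rewrite !(exprMn, exprVn) !sqr_sqrtr//; last 2 first.
  - by rewrite -exprMn.
  - by rewrite -exprVn -exprMn.
  have ed (x : R) : x ^+ d = x ^+ #|J| * x ^+ m by rewrite -exprD Jd.
  have f4 : 4 ^+ m = 2 ^+ m * 2 ^+ m :> R.
    by rewrite -exprMn; congr (_ ^+ _); rewrite -natrM.
  rewrite exprD !ed /p -/s0 !(exprMn, exprVn) f4.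
  have b1 : b ^+ #|J| != 0 by rewrite expf_neq0 ?gt_eqF.
  have b2 : b ^+ m != 0 by rewrite expf_neq0 ?gt_eqF.
  have b3 : 2 ^+ #|J| != 0 :> R by rewrite expf_neq0.
  have b4 : 2 ^+ m != 0 :> R by rewrite expf_neq0.
  have b5 : pi ^+ m != 0 :> R by rewrite expf_neq0 ?gt_eqF.
  have b6 : pi != 0 :> R by rewrite gt_eqF.
  have b7 : b != 0 by rewrite gt_eqF.
  have b8 : s0 != 0 by rewrite gt_eqF.
  have b9 : Ps != 0 by rewrite gt_eqF.
  clear -b1 b2 b3 b4 b5 b6 b7 b8 b9; clearbody s0 Ps m.
  move: b1 b2 b3 b4 b5 b6 b7 b8 b9.
  move: (pi : R) (b ^+ #|J|) (b ^+ m) (2 ^+ #|J| : R) (2 ^+ m : R) (pi ^+ m : R).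
  move=> x6 x1 x2 x3 x4 x5 h1 h2 h3 h4 h5 h6 h7 h8 h9.
  by apply/eqP; field; rewrite ?(h1, h2, h3, h4, h5, h6, h7, h8, h9).
rewrite EnJ (gamma1_ratioE (p0 ord0)) (gamma1_ratioE N0) E4 EJ Eb.
have R0 : Num.sqrt (pi * p ord0) != 0 by rewrite gt_eqF// sqrtr_gt0 mulr_gt0.
have R1 : Num.sqrt ((pi / b) ^+ m * Ps) != 0.
  by rewrite gt_eqF// sqrtr_gt0 mulr_gt0// exprn_gt0// divr_gt0.
have R2 : Num.sqrt (pi * b^-1) != 0 by rewrite gt_eqF// sqrtr_gt0 mulr_gt0.
have R3 : 4 `^ p ord0 != 0 :> R by rewrite gt_eqF// powR_gt0.
have R4 : \prod_(j in J) 4 `^ (p (lift ord0 j)) != 0 :> R.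
  by rewrite gt_eqF// prodr_gt0// => j _; rewrite powR_gt0.
have R5 : \prod_(j in ~: J) 4 `^ (p (lift ord0 j)) != 0 :> R.
  by rewrite gt_eqF// prodr_gt0// => j _; rewrite powR_gt0.
have R6 : 2 ^+ #|J| != 0 :> R by rewrite expf_neq0.
have R7 : gamma1_rho b^-1 != 0.
  by rewrite gt_eqF// gamma1_rho_gt0.
move: key R0 R1 R2 R3 R4 R5 R6 R7.
move: (Num.sqrt (pi * p ord0)) (Num.sqrt ((pi / b) ^+ m * Ps)) (Num.sqrt (pi * b^-1))
  (4 `^ p ord0 : R) (\prod_(j in J) 4 `^ (p (lift ord0 j)) : R)
  (\prod_(j in ~: J) 4 `^ (p (lift ord0 j)) : R) (2 ^+ #|J| : R) (gamma1_rho b^-1)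
  (b `^ ((d + #|J|)%:R / 2)) ((2 * b) ^+ d) (psi J s) (gamma1_rho (p ord0))
  (\prod_(j in ~: J) gamma1_rho (p (lift ord0 j))) (\prod_(j in J) gamma1_ratio (p (lift ord0 j)))
  (\prod_(i < d) ((b^-1 + i.+1%:R) ^+ 2 / (2 * b^-1 + i.+1%:R))).
clear => x1 x2 x3 x4 x5 x6 x7 x8 x9 y1 y2 y3 y4 y5 y6 key h1 h2 h3 h4 h5 h6 h7 h8.
transitivity ((x3 / (x1 * x2) * x9) * (y3 * y5 * y4 * y6 / (x8 * x5))).
  by field; rewrite ?(h1, h2, h3, h4, h5, h6, h7, h8).
by rewrite key; field; rewrite ?(h1, h2, h3, h4, h5, h6, h7, h8).
Qed.

End dirichlet_kernel.

(** * Behaviour of the exponents and of the square integral as b tends to 0 *)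

Section kernel_asymptotics.
Context {R : realType} {d : nat}.
Variables (b : nat -> R) (s : nat -> 'rV[R]_d) (J : {set 'I_d}) (lambda : 'rV[R]_d).
Hypothesis b_gt0 : forall n, (0 < n)%N -> 0 < b n.
Hypothesis b_cvg : b n @[n --> \oo] --> 0.
Hypothesis s_int : forall n, (0 < n)%N -> simplex_int R d (s n).
Hypothesis lambda_gt1 : forall j, 1 < lambda 0 j.
Hypothesis s_lambda : forall j, j \in J -> s n 0 j / b n @[n --> \oo] --> lambda 0 j.
Hypothesis s_fixed : forall j, j \notin J ->
  forall n n', (0 < n)%N -> (0 < n')%N -> s n 0 j = s n' 0 j.

Definition dirichlet_exponent n k : R := bary (s n) k / b n.

Local Notation p := dirichlet_exponent.

Lemma near_pos : \forall n \near \oo, (0 < n)%N.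
Proof. by exists 1%N. Qed.

Lemma cvg_invb : (b n)^-1 @[n --> \oo] --> +oo.
Proof.
apply/gtr0_cvgV0; first by near=> n; rewrite invr_gt0 b_gt0//; near: n; exact: near_pos.
apply: (@cvg_trans _ (b n @[n --> \oo])) => //.
by apply: near_eq_cvg; near=> n; rewrite /= invrK.
Unshelve. all: by end_near. Qed.

Lemma cvg_div_b (u : nat -> R) (c : R) : 0 < c ->
  (\forall n \near \oo, c <= u n) -> u n / b n @[n --> \oo] --> +oo.
Proof.
move=> c0 cu; apply/cvgryPgt => A; near=> n.
have n0 : (0 < n)%N by near: n; exact: near_pos.
have h1 : A / c < (b n)^-1 by near: n; move/cvgryPgt : cvg_invb; exact.
have h2 : c <= u n by near: n.
apply: (@lt_le_trans _ _ (c / b n)); first by rewrite mulrC -ltr_pdivrMr.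
by rewrite ler_wpM2r// invr_ge0 ltW// b_gt0.
Unshelve. all: by end_near. Qed.

(** The limit of the slack: coordinates in [J] vanish like [b]. The fixed ones are read at index 1,
    as nothing is assumed of [s 0]. *)
Let t0 : R := 1 - \sum_(j in ~: J) s 1%N 0 j.

Lemma bary0_split n : (0 < n)%N -> bary (s n) ord0 = t0 - \sum_(j in J) s n 0 j.
Proof.
move=> n0; rewrite bary0 (bigID (mem J))/= opprD addrA addrAC; congr (_ - _).
rewrite /t0; congr (_ - _); apply: eq_big => [j|j jJ]; first by rewrite finset.in_setC.
exact: s_fixed.
Qed.

Lemma t0_gt0 : 0 < t0.
Proof.
have -> : t0 = bary (s 1%N) ord0 + \sum_(j in J) s 1%N 0 j by rewrite bary0_split// subrK.
apply: ltr_wpDr; last exact: simplex_int_bary_gt0 (s_int _).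
apply: sumr_ge0 => j _; rewrite -baryS ltW//; exact: simplex_int_bary_gt0 (s_int _).
Qed.

Lemma cvg_bary0 : bary (s n) ord0 @[n --> \oo] --> t0.
Proof.
apply: (@cvg_trans _ (t0 - \sum_(j in J) (s n 0 j / b n) * b n @[n --> \oo])).
  apply: near_eq_cvg; near=> n.
  have n0 : (0 < n)%N by near: n; exact: near_pos.
  rewrite bary0_split//; congr (_ - _); apply: eq_bigr => j _.
  by rewrite divfK// gt_eqF// b_gt0.
suff : t0 - \sum_(j in J) (s n 0 j / b n) * b n @[n --> \oo] -->
    t0 - \sum_(j in J) lambda 0 j * 0.
  by under [X in _ --> _ - X]eq_bigr do rewrite mulr0; rewrite big1// subr0.
apply: cvgB; first exact: cvg_cst.
apply: (@cvg_big R 'I_d (@GRing.add R) 0 (mem J) (@add_continuous R)) => j jJ.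
by apply: cvgM => //; exact: s_lambda.
Unshelve. all: by end_near. Qed.

Lemma cvg_exponent0 : p n ord0 @[n --> \oo] --> +oo.
Proof.
have t20 : 0 < t0 / 2 by rewrite divr_gt0// t0_gt0.
apply: (cvg_div_b t20); near=> n; apply: ltW; near: n.
by apply: (cvgr_gt _ cvg_bary0); have := t0_gt0; lra.
Unshelve. all: by end_near. Qed.

Lemma cvg_exponent_fixed j : j \notin J -> p n (lift ord0 j) @[n --> \oo] --> +oo.
Proof.
move=> jJ; have s0 : 0 < s 1%N 0 j.
  by rewrite -baryS; exact: simplex_int_bary_gt0 (s_int _).
apply: (cvg_div_b s0); near=> n; rewrite baryS (s_fixed jJ (n' := n))//.
by near: n; exact: near_pos.
Unshelve. all: by end_near. Qed.

Lemma cvg_exponent_lambda j : j \in J -> p n (lift ord0 j) @[n --> \oo] --> lambda 0 j.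
Proof.
by move=> jJ; rewrite /p; under eq_cvg do rewrite baryS; exact: s_lambda.
Qed.

(** The condition for lowering exponents in the Lipschitz bound: outside [J] and for the slack the
    exponents tend to infinity, in [J] to a limit above 1. *)
Lemma near_exponent_ge1 : \forall n \near \oo, forall k, 1 <= p n k.
Proof.
apply: filter_forall => k; case: (fintype.unliftP ord0 k) => [j|] ->; last first.
  by move/cvgryPge : cvg_exponent0; exact.
have [jJ|jJ] := boolP (j \in J); last by move/cvgryPge : (cvg_exponent_fixed jJ); exact.
near=> n; apply: ltW; near: n.
exact: (cvgr_gt _ (cvg_exponent_lambda jJ)).
Unshelve. all: by end_near. Qed.

(** Outside [J] the coordinates are constant and the slack stays above half its limit. Boundedness
    of [psi] converts a relative error on the square integral into an additive o(1). *)
Lemma psi_bounded : exists M, \forall n \near \oo, 0 <= psi J (s n) <= M.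
Proof.
pose C := (4 * pi) ^+ (d - #|J|) * (t0 / 2) * \prod_(j in ~: J) s 1%N 0 j.
have s1 j : 0 < s 1%N 0 j by rewrite -baryS; exact: simplex_int_bary_gt0 (s_int _).
have C0 : 0 < C.
  rewrite /C; apply: mulr_gt0; last exact: prodr_gt0.
  apply: mulr_gt0; first by rewrite exprn_gt0// mulr_gt0// pi_gt0.
  by rewrite divr_gt0// t0_gt0.
exists (C `^ (- 2^-1)); near=> n.
have n0 : (0 < n)%N by near: n; exact: near_pos.
have sn k : 0 < bary (s n) k by apply: simplex_int_bary_gt0; exact: s_int.
have t2 : t0 / 2 <= bary (s n) ord0.
  apply: ltW; near: n; apply: (cvgr_gt _ cvg_bary0).
  by have := t0_gt0; lra.
set X := (4 * pi) ^+ (d - #|J|) * bary (s n) ord0 * \prod_(j in ~: J) s 1%N 0 j.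
have CX : C <= X.
  rewrite ler_wpM2r ?prodr_ge0// => [j _|]; first exact: ltW.
  by rewrite ler_wpM2l// exprn_ge0// mulr_ge0// pi_ge0.
have X0 : 0 < X by exact: lt_le_trans CX.
have -> : psi J (s n) = X `^ (- 2^-1).
  rewrite /psi /X bary0 l1norm_sum => [|j]; last by rewrite -baryS ltW.
  congr ((_ * _) `^ _); apply: eq_bigr => j; rewrite finset.in_setC => jJ.
  exact: s_fixed.
rewrite powR_ge0/= !powRN lef_pV2 ?posrE ?powR_gt0//.
by rewrite ge0_ler_powR ?nnegrE ?(ltW C0) ?(ltW X0).
Unshelve. all: by end_near. Qed.

(** [psi] is kept outside the limit because it is evaluated at the moving point [s n]. *)
Lemma cvg_dpdf2_rescaled :
  exists2 c : nat -> R,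
    c n @[n --> \oo] --> \prod_(j in J) (Gamma (2 * lambda 0 j + 1) /
             (2 `^ (2 * lambda 0 j + 1) * Gamma (lambda 0 j + 1) ^+ 2)) &
    forall n, (0 < n)%N ->
      dpdf2 (p n) * b n `^ ((d + #|J|)%:R / 2) = psi J (s n) * c n.
Proof.
exists (fun n => gamma1_rho (p n ord0) * (\prod_(j in ~: J) gamma1_rho (p n (lift ord0 j))) *
     (\prod_(j in J) (gamma1_ratio (p n (lift ord0 j)) / (2 * 4 `^ (p n (lift ord0 j))))) /
     gamma1_rho (b n)^-1 *
     \prod_(i < d) (2 * b n * ((b n)^-1 + i.+1%:R) ^+ 2 / (2 * (b n)^-1 + i.+1%:R)));
  last by move=> n n0; apply: dpdf2_rescaled; [exact: s_int|exact: b_gt0].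
set c := \prod_(j in J) _.
have mulc := @mul_continuous R.
(* Clearing the inverse of [w], here [b n], shows that the rational factor tends to 1. *)
have aux (v w : R) : 0 < w -> 0 <= v ->
    (1 + v * w) ^+ 2 * (2 / (2 + v * w)) = 2 * w * (w^-1 + v) ^+ 2 / (2 * w^-1 + v).
  move=> w0 v0; have h : 0 <= v * w by rewrite mulr_ge0// ltW.
  by field; apply/andP; split; apply: lt0r_neq0; lra.
suff : gamma1_rho (p n ord0) * (\prod_(j in ~: J) gamma1_rho (p n (lift ord0 j))) *
     (\prod_(j in J) (gamma1_ratio (p n (lift ord0 j)) / (2 * 4 `^ (p n (lift ord0 j))))) /
     gamma1_rho (b n)^-1 *
     \prod_(i < d) (2 * b n * ((b n)^-1 + i.+1%:R) ^+ 2 / (2 * (b n)^-1 + i.+1%:R))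
     @[n --> \oo] --> 1 * (\prod_(j in ~: J) 1) * c / 1 * \prod_(i < d) (1 : R).
  by rewrite !big1// divr1 !mulr1 mul1r.
apply: cvgM; last first.
  apply: (@cvg_big R 'I_d (@GRing.mul R) 1 xpredT mulc) => i _.
  apply: (@cvg_trans _ ((1 + i.+1%:R * b n) ^+ 2 * (2 / (2 + i.+1%:R * b n)) @[n --> \oo])).
    apply: near_eq_cvg; near=> n.
    have n0 : (0 < n)%N by near: n; exact: near_pos.
    by apply: aux; [exact: b_gt0|exact: ler0n].
  suff : (1 + i.+1%:R * b n) * (1 + i.+1%:R * b n) * (2 / (2 + i.+1%:R * b n)) @[n --> \oo] -->
      ((1 + i.+1%:R * 0) * (1 + i.+1%:R * 0) * (2 / (2 + i.+1%:R * 0)) : R).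
    by rewrite !mulr0 !addr0 !mul1r divff.
  have ib : i.+1%:R * b n @[n --> \oo] --> i.+1%:R * (0 : R).
    by apply: cvgM => //; exact: cvg_cst.
  have ib1 (a : R) : a + i.+1%:R * b n @[n --> \oo] --> a + i.+1%:R * (0 : R).
    by apply: cvgD => //; exact: cvg_cst.
  apply: cvgM; first exact: cvgM.
  apply: cvgM; first exact: cvg_cst.
  by apply: cvgV => //; rewrite mulr0 addr0.
apply: cvgM; last first.
  by apply: cvgV; [exact: oner_neq0|exact: cvg_gamma1_rho cvg_invb].
apply: cvgM; last first.
  apply: (@cvg_big R 'I_d (@GRing.mul R) 1 (mem J) mulc) => j jJ.
  have l0 : 0 < lambda 0 j by rewrite (lt_trans _ (lambda_gt1 j)).
  have -> : Gamma (2 * lambda 0 j + 1) / (2 `^ (2 * lambda 0 j + 1) * Gamma (lambda 0 j + 1) ^+ 2)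
     = gamma1 (2 * lambda 0 j) / gamma1 (lambda 0 j) ^+ 2 / (2 * 4 `^ (lambda 0 j)).
    rewrite !Gamma_gamma1 powRD ?pnatr_eq0 ?implybT// powRr1// powRrM.
    rewrite (_ : 2 `^ 2 = 4 :> R); last by rewrite powR_mulrn// -natrX.
    have : 0 < 4 `^ (lambda 0 j) :> R by rewrite powR_gt0.
    have := gamma1_gt0 (ltW l0).
    generalize (gamma1 (lambda 0 j)) (4 `^ (lambda 0 j)) (gamma1 (2 * lambda 0 j)).
    by move=> x y z x0 y0; field; rewrite !gt_eqF.
  have pl := cvg_exponent_lambda jJ.
  have p2l : 2 * p n (lift ord0 j) @[n --> \oo] --> 2 * lambda 0 j.
    by apply: cvgM => //; exact: cvg_cst.
  have gl := cvg_comp _ _ pl (continuous_gamma1 l0).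
  have g2l := cvg_comp _ _ p2l (continuous_gamma1 (mulr_gt0 (ltr0n R 2) l0)).
  have gl0 : gamma1 (lambda 0 j) != 0 by rewrite gt_eqF// gamma1_gt0// ltW.
  have gsq : gamma1 (p n (lift ord0 j)) ^+ 2 @[n --> \oo] --> gamma1 (lambda 0 j) ^+ 2.
    by rewrite expr2; exact: (cvgM gl gl).
  have gr : gamma1_ratio (p n (lift ord0 j)) @[n --> \oo] -->
      gamma1 (2 * lambda 0 j) / gamma1 (lambda 0 j) ^+ 2.
    by rewrite /gamma1_ratio; apply: (cvgM g2l); apply: (cvgV _ gsq); rewrite expf_neq0.
  apply: (cvgM gr).
  apply: cvgV; first by rewrite gt_eqF// mulr_gt0// powR_gt0.
  apply: cvgM; first exact: cvg_cst.
  have p4 (x : R) : 4 `^ x = expR (x * ln 4) by rewrite /powR pnatr_eq0.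
  rewrite p4; under eq_cvg do rewrite p4.
  apply: (cvg_comp _ expR); last exact: continuous_expR.
  by apply: cvgM => //; exact: cvg_cst.
apply: cvgM; first exact: cvg_gamma1_rho cvg_exponent0.
apply: (@cvg_big R 'I_d (@GRing.mul R) 1 (mem (~: J)) mulc) => j.
rewrite /= finset.in_setC => jJ; exact: cvg_gamma1_rho (cvg_exponent_fixed jJ).
Unshelve. all: by end_near. Qed.

End kernel_asymptotics.

(** * The Gasser-Muller weights *)

Section gm_sum.
Context {R : realType} {d : nat}.
Notation mu := (@lebesgue_rV R d).
Notation "`d( x , y )" := (\sum_(j < d) `|x 0 j - y 0 j|).

(** The Lipschitz predicate holds for all constants above some [M], hence the choice of
    [max 0 (M + 1)]. The sup norm is at most the l1 distance, which is what barycentric deviations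
    control. *)
Lemma lipschitz_coord (A : set 'rV[R]_d) (h : 'rV[R]_d -> R) :
  [lipschitz (h t : R^o) | t in A] ->
  exists2 L, 0 <= L & forall x y, A x -> A y -> `|h x - h y| <= L * `d(x, y).
Proof.
case => M [_ hM]; pose L := Num.max 0 (M + 1).
have ML : M < L by rewrite lt_max ltrDl ltr01 orbT.
exists L => [|x y Ax Ay]; first by rewrite le_max lexx.
have /= h1 := hM L ML (x, y) (conj Ax Ay).
apply: le_trans h1 _; rewrite ler_wpM2l ?le_max ?lexx//.
rewrite [leLHS](_ : _ = mx_norm (x - y))// mx_normrE; apply: bigmax_le.
  by apply: sumr_ge0 => j _.
move=> [i j] _; rewrite /= ord1 !mxE (bigD1 j)//= lerDl.
by apply: sumr_ge0 => k _.
Qed.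

Lemma compact_measurable_rV (A : set 'rV[R]_d) : compact A -> measurable A.
Proof.
move=> cA; have clA : closed A by apply: (compact_closed _ cA); exact: norm_hausdorff.
by rewrite -[A]setCK; apply: measurableC; apply: open_measurable_rV; rewrite openC.
Qed.

(** With all exponents zero the weight is 1 on the closed simplex, so its finite Dirichlet mass
    dominates. *)
Lemma measure_simplex_fin (A : set 'rV[R]_d) :
  measurable A -> A `<=` simplex R d -> (mu A < +oo)%E.
Proof.
move=> mA AS; pose z : 'I_d.+1 -> R := fun=> 0.
have z0 k : 0 <= z k by [].
apply: (@le_lt_trans _ _ (dmass z)%:E); last exact: ltry.
rewrite -(integral_dweight z0) -[mu A]mul1e -integral_cst// integral_mkcond.
apply: ge0_le_integral => //.
- by move=> x _; rewrite patchE; case: ifP.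
- by apply/(measurable_restrictT _ mA); exact: measurable_cst.
- by apply/measurable_EFinP; exact: measurable_dweight.
- move=> x _; rewrite patchE; case: ifPn => [/set_mem Ax|_]; last by rewrite lee_fin dweight_ge0.
  rewrite lee_fin /dweight big1// => k _.
  by rewrite /tpow simplex_bary_ge0 ?powRr0//; exact: AS.
Qed.

Lemma dpdf_out (p : 'I_d.+1 -> R) x : (forall k, 0 < p k) -> ~ simplex R d x -> dpdf p x = 0.
Proof.
move=> p0 nx; rewrite /dpdf.
have [k xk] : exists k, bary x k < 0.
  apply: contrapT => h; apply: nx; apply: bary_ge0_simplex => k.
  by rewrite leNgt; apply/negP => xk; apply: h; exists k.
by rewrite /dweight (bigD1 k)//= tpow_lt0// !mul0r.
Qed.

(** The three summands of the bound are the costs of the three replacements: [de] bounds coordinate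
    differences within a cell, [tau] stands for n^(-1/d), [e] is the parameter of [dpdf2_deviation],
    [La / n] bounds the volume of a cell and [l] is a Lipschitz constant of [sigma2 / f]. *)
Lemma gm_sum_estimate (n : nat) (B : 'I_n -> set 'rV[R]_d) (xs : 'I_n -> 'rV[R]_d)
    (s : 'rV[R]_d) (f sigma2 : 'rV[R]_d -> R) (b Lf Ls S c C2 tau de e : R) :
  (0 < n)%N -> (forall i, compact (B i)) -> (forall i, B i `<=` simplex R d) ->
  (forall i j, i != j -> (B i)° `&` (B j)° = set0) ->
  \bigcup_(i in [set: 'I_n]) B i = simplex R d ->
  (forall i, mu (boundary (B i)) = 0%E) -> (forall i, B i (xs i)) ->
  (forall i x y, B i x -> B i y -> forall j, `|x 0 j - y 0 j| <= de) ->
  mu.-integrable (simplex R d) (EFin \o f) ->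
  (forall i, `|\int[mu]_(t in B i) f t - n%:R^-1| <= C2 * tau / n%:R) ->
  0 < c -> (forall x, simplex R d x -> c <= f x) ->
  (forall x, simplex R d x -> 0 <= sigma2 x <= S) ->
  0 <= Lf -> (forall x y, simplex R d x -> simplex R d y -> `|f x - f y| <= Lf * `d(x, y)) ->
  0 <= Ls -> (forall x y, simplex R d x -> simplex R d y ->
    `|sigma2 x - sigma2 y| <= Ls * `d(x, y)) ->
  0 <= C2 -> 0 <= tau <= 1 -> 0 <= de -> 0 < e ->
  simplex_int R d s -> 0 < b -> (forall k, 1 <= bary s k / b) ->
  let p k := bary s k / b in
  let La := (1 + C2) / c in
  let l := Ls / c + S * Lf / c ^+ 2 in
  `|n%:R * (\sum_i sigma2 (xs i) * (\int[mu]_(x in B i) dpdf p x) ^+ 2) -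
    sigma2 s / f s * dpdf2 p| <=
  (S * La * ((d.+1 * d)%:R * 2 ^+ d * ((2 * b^-1 + d%:R) * de)) +
   S * ((Lf * (d%:R * de) * La + C2 * tau) / c) +
   l * (d%:R * de + d.+1%:R * (e + e^-1 * ((1 + d.+1%:R ^+ 2) / (2 * b^-1 + d.+1%:R))))) * dpdf2 p.
Proof.
move=> n0 cB BS dB UB bB Bxs hde iF hmass c0 fc sS Lf0 lf Ls0 ls C20.
move=> /andP[t0 t1] de0 e0 sI b0 p1.
cbv zeta; set p := (fun k => bary s k / b); set La := (1 + C2) / c.
set l := Ls / c + _.
have pp k : 0 < p k by rewrite (lt_le_trans ltr01)// p1.
have pge k : 0 <= p k by rewrite ltW.
have N0 : 0 < n%:R :> R by rewrite ltr0n.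
have mB i : measurable (B i) by exact: compact_measurable_rV.
have Bfin i : (mu (B i) < +oo)%E by exact: measure_simplex_fin.
have SN : \sum_k p k = b^-1 by rewrite -mulr_suml sum_bary mul1r.
have ss := simplex_int_sub sI.
have A0 := dpdf2_gt0 pge.
pose L i := fine (mu (B i)).
have L0 i : 0 <= L i by rewrite fine_ge0.
pose k i := \int[mu]_(x in B i) dpdf p x.
pose v i := \int[mu]_(x in B i) (dpdf p x ^+ 2).
pose dev x := (\sum_k `|bary x k - p k / \sum_i p i|) * dpdf p x ^+ 2.
pose w i := \int[mu]_(x in B i) dev x.
have ik := integrable_dpdf pge.
have ik2 := integrable_dpdf2 pge.
have [idev ledev] := dpdf2_deviation pp e0.
have devE x : dev x = (\sum_k `|bary x k - bary s k|) * dpdf p x ^+ 2.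
  rewrite /dev SN; congr (_ * _); apply: eq_bigr => i _.
  by rewrite /p invrK divfK ?gt_eqF.
have sumk : \sum_i k i = 1.
  rewrite -(Rintegral_dpdf pge); symmetry; apply: Rintegral_tiling UB bB ik _ => //.
  by move=> x; exact: dpdf_out.
have sumv : \sum_i v i = dpdf2 p.
  rewrite -(Rintegral_dpdf2 pge); symmetry; apply: Rintegral_tiling UB bB ik2 _ => //.
  by move=> x nx; rewrite dpdf_out// expr0n.
have sumw : \sum_i w i = \int[mu]_x dev x.
  symmetry; apply: Rintegral_tiling UB bB idev _ => //.
  by move=> x nx; rewrite /dev dpdf_out// expr0n mulr0.
have ifB i : mu.-integrable (B i) (EFin \o f).
  apply: integrableS iF; [|exact: mB|exact: BS].
  by rewrite -UB; apply: fin_bigcup_measurable.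
have icB i (a : R) : mu.-integrable (B i) (fun=> a%:E) by exact: integrable_cst_in.
have dist i x y : B i x -> B i y -> `d(x, y) <= d%:R * de.
  move=> Bx By; apply: (@le_trans _ _ (\sum_(j < d) de)).
    by apply: ler_sum => j _; exact: hde Bx By j.
  by rewrite sumr_const card_ord mulr_natl.
(* [c] times the volume is at most the [f]-mass of the cell, itself at most [(1 + C2 * tau) / n]
   with [tau <= 1]. *)
have LLa i : L i <= La / n%:R.
  rewrite /La mulrAC ler_pdivlMr// mulrC.
  have -> : c * L i = \int[mu]_(x in B i) c by rewrite Rintegral_cst.
  apply: (@le_trans _ _ (\int[mu]_(t in B i) f t)).
    apply: le_Rintegral => //; first exact: icB.
    by move=> x Bx; apply: fc; exact: BS Bx.
  have := hmass i; rewrite ler_norml => /andP[_]; rewrite lerBlDr => h.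
  apply: le_trans h _; rewrite mulrDl mul1r addrC lerD2l ler_wpM2r ?invr_ge0 ?(ltW N0)//.
  by rewrite ler_piMr.
have fL i : `|f (xs i) * L i - n%:R^-1| <= (Lf * (d%:R * de) * La + C2 * tau) / n%:R.
  rewrite (_ : _ - _ = (f (xs i) * L i - \int[mu]_(t in B i) f t) +
    (\int[mu]_(t in B i) f t - n%:R^-1)); last by ring.
  apply: le_trans (ler_normD _ _) _; rewrite mulrDl; apply: lerD => //.
  have -> : f (xs i) * L i = \int[mu]_(t in B i) f (xs i) by rewrite Rintegral_cst.
  have iD := integrableB (mB i) (icB i (f (xs i))) (ifB i).
  rewrite -RintegralB//; last exact: icB.
  apply: le_trans (le_normr_Rintegral _ _) _ => //.
  apply: (@le_trans _ _ (\int[mu]_(t in B i) (Lf * (d%:R * de)))).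
    apply: le_Rintegral => //; first exact: (integrable_norm iD).
      exact: icB.
    move=> x Bx; apply: le_trans (lf _ _ _ _) _; [exact: BS (Bxs i)|exact: BS Bx|].
    by rewrite ler_wpM2l//; exact: (dist i).
  rewrite Rintegral_cst// -[leRHS]mulrA ler_wpM2l ?mulr_ge0//; exact: LLa.
have xS i : simplex R d (xs i) by exact: BS (Bxs i).
have f0 i : 0 < f (xs i) by rewrite (lt_le_trans c0)// fc.
have fs0 : 0 < f s by rewrite (lt_le_trans c0)// fc.
have S0 : 0 <= S by have /andP[? ?] := sS _ ss; exact: le_trans (_ : sigma2 s <= S).
have glip x : simplex R d x -> `|sigma2 x / f x - sigma2 s / f s| <= l * `d(x, s).
  move=> Sx; have fx0 : 0 < f x by rewrite (lt_le_trans c0)// fc.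
  have Sx2 := sS _ Sx; have Ss2 := sS _ ss.
  have cx := fc _ Sx; have cs := fc _ ss.
  have D0 : 0 <= `d(x, s) by apply: sumr_ge0.
  rewrite (_ : _ - _ = (sigma2 x - sigma2 s) / f x + sigma2 s * ((f s - f x) / (f x * f s))); last first.
    by field; rewrite !gt_eqF.
  apply: le_trans (ler_normD _ _) _; rewrite /l [leRHS]mulrDl; apply: lerD.
    rewrite normrM normfV (gtr0_norm fx0) [leRHS]mulrAC ler_pM ?invr_ge0 ?(ltW fx0)//.
      exact: ls.
    by rewrite lef_pV2 ?posrE.
  case/andP: Ss2 => Ss0 SsS.
  rewrite normrM (ger0_norm Ss0).
  rewrite (_ : S * Lf / c ^+ 2 * _ = S * ((Lf * `d(x, s)) * (c ^+ 2)^-1)); last by ring.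
  apply: ler_pM => //.
  rewrite normrM normfV distrC (gtr0_norm (mulr_gt0 fx0 fs0)).
  apply: ler_pM => //; first by rewrite invr_ge0 mulr_ge0 ?(ltW fx0) ?(ltW fs0).
    exact: lf.
  by rewrite lef_pV2 ?posrE ?mulr_gt0// expr2 ler_pM ?(ltW c0).
set eta := (d.+1 * d)%:R * 2 ^+ d * ((2 * b^-1 + d%:R) * de).
have eta0 : 0 <= eta.
  rewrite /eta !mulr_ge0 ?exprn_ge0//.
  by rewrite addr_ge0// mulr_ge0// invr_ge0 ltW.
set X := Lf * (d%:R * de) * La + C2 * tau in fL *.
have h1 i : `|k i ^+ 2 - L i * v i| <= L i * (eta * dpdf2 p) * k i.
  apply: sqr_Rintegral_dev => // [x|x y Bx By]; first exact: dpdf_ge0.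
  rewrite /eta -SN; apply: dpdf_lipschitz => // [k'|k'|j].
  - by apply: simplex_bary_ge0; exact: BS Bx.
  - by apply: simplex_bary_ge0; exact: BS By.
  - exact: hde Bx By j.
have h3 i : `|sigma2 (xs i) * L i - sigma2 (xs i) / f (xs i) / n%:R| <= S * (X / c) / n%:R.
  have /andP[s0 sSi] := sS _ (xS i).
  rewrite (_ : _ - _ = sigma2 (xs i) / f (xs i) * (f (xs i) * L i - n%:R^-1)); last first.
    by field; rewrite !gt_eqF.
  rewrite normrM ger0_norm ?divr_ge0 ?(ltW (f0 i))//.
  rewrite (_ : S * (X / c) / n%:R = S / c * (X / n%:R)); last by field; rewrite !gt_eqF.
  apply: ler_pM => //; first by rewrite divr_ge0 ?(ltW (f0 i)).
  by rewrite ler_pM ?invr_ge0 ?(ltW (f0 i))// lef_pV2 ?posrE// fc.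
have l0 : 0 <= l.
  by rewrite /l addr_ge0 ?divr_ge0 ?mulr_ge0 ?exprn_ge0 ?(ltW c0).
have h5 i : `|sigma2 (xs i) / f (xs i) - sigma2 s / f s| * v i <= l * (d%:R * de * v i + w i).
  have iv : mu.-integrable (B i) (EFin \o (fun x => dpdf p x ^+ 2)) by apply: integrableS ik2.
  have iw : mu.-integrable (B i) (EFin \o dev) by apply: integrableS idev.
  have iv' := integrableZl (mB i) (d%:R * de) iv.
  have ivw := integrableD (mB i) iv' iw.
  rewrite /v /w -[d%:R * de * _](RintegralZl _ (mB i) iv) -(RintegralD (mB i) iv' iw).
  rewrite -(RintegralZl _ (mB i) iv) -(RintegralZl _ (mB i) ivw).
  apply: le_Rintegral => //.
  - exact: (integrableZl (mB i) _ iv).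
  - exact: (integrableZl (mB i) _ ivw).
  move=> x Bx; rewrite devE -mulrDl mulrA ler_wpM2r ?sqr_ge0//.
  apply: le_trans (glip _ (xS i)) _; rewrite ler_wpM2l//.
  (* The distance from the design point to [s] passes through the integration point [x]; its second
     leg is at most the sum of all barycentric deviations, slack included. *)
  apply: (@le_trans _ _ (`d(xs i, x) + `d(x, s))).
    rewrite -big_split/=; apply: ler_sum => j _; exact: ler_distD.
  apply: lerD; first exact: (dist i).
  rewrite [leRHS]big_ord_recl; apply: ler_wpDl => //.
  by apply: ler_sum => j _; rewrite !baryS.
have := @weighted_sum_bound _ n k v w L (fun i => sigma2 (xs i))
  (fun i => sigma2 (xs i) / f (xs i)) n%:R S La (X / c) (eta * dpdf2 p)
  l (d%:R * de) (sigma2 s / f s) (dpdf2 p) (\int[mu]_x dev x) N0 h1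
  (fun i => sS _ (xS i)) h3 _ h5 _ _ _ sumk sumv sumw.
move=> h; apply: le_trans (h _ _ _ _) _.
- by move=> i; rewrite L0 LLa.
- by rewrite mulr_ge0// ltW.
- by move=> i; apply: Rintegral_ge0 => x _; exact: dpdf_ge0.
- by move=> i; apply: Rintegral_ge0 => x _; exact: sqr_ge0.
have hW : \int[mu]_x dev x <= d.+1%:R * (e + e^-1 * ((1 + d.+1%:R ^+ 2) / (2 * b^-1 + d.+1%:R))) * dpdf2 p.
  by apply: le_trans ledev _; rewrite SN.
rewrite [leRHS]mulrDl [X in _ <= X + _]mulrDl; apply: lerD; first by rewrite !mulrA.
by rewrite -[leRHS]mulrA ler_wpM2l// [leRHS]mulrDl lerD2l.
Qed.

End gm_sum.

Section gm_asymptotics.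
Context {R : realType} {d : nat}.
Notation "`d( x , y )" := (\sum_(j < d) `|x 0 j - y 0 j|).

Lemma coord_le_diam (A : set 'rV[R]_d) x y j : A `<=` simplex R d -> A x -> A y ->
  `|x 0 j - y 0 j| <= diam A.
Proof.
move=> AS Ax Ay; apply: (@le_trans _ _ (l2norm (x - y))).
  rewrite /l2norm -sqrtr_sqr ler_wsqrtr// (bigD1 j)//= !mxE lerDl.
  by apply: sumr_ge0 => k _; exact: sqr_ge0.
apply: ub_le_sup; last by exists (x, y).
(* [sup] is an upper bound only for a bounded set: on the simplex coordinate differences are at most
   1. *)
exists (Num.sqrt d%:R) => _ [[u v] [/= Au Av] <-].
apply: ler_wsqrtr; rewrite -[d in leRHS]card_ord -sumr_const; apply: ler_sum => k _.
have /andP[u0 u1] := (AS _ Au).1 k; have /andP[v0 v1] := (AS _ Av).1 k.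
by rewrite !mxE -real_normK ?num_real// exprn_ile1// ler_norml; apply/andP; split; lra.
Qed.

Lemma simplex_dist x y : simplex R d x -> simplex R d y -> `d(x, y) <= 2.
Proof.
move=> [_ x1] [_ y1]; apply: (@le_trans _ _ (l1norm x + l1norm y)).
  by rewrite -big_split; apply: ler_sum => j _; exact: ler_normB.
by rewrite (_ : 2 = 1 + 1 :> R) ?lerD.
Qed.

Lemma lipschitz_simplex_bounded (h : 'rV[R]_d -> R) (L : R) : 0 <= L ->
  (forall x y, simplex R d x -> simplex R d y -> `|h x - h y| <= L * `d(x, y)) ->
  exists S, forall x, simplex R d x -> h x <= S.
Proof.
move=> L0 lh.
have S0 : simplex R d 0.
  by split=> [j|]; rewrite ?mxE ?lexx ?ler01// /l1norm big1 ?ler01// => j _; rewrite mxE normr0.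
exists (h 0 + L * 2) => x Sx; rewrite -lerBlDl.
apply: le_trans (ler_norm _) _; apply: le_trans (lh _ _ Sx S0) _.
by rewrite ler_wpM2l// simplex_dist.
Qed.

Lemma rate_cvg (b t : nat -> R) : b n @[n --> \oo] --> 0 ->
  (forall n, (0 < n)%N -> 0 < b n) -> (forall n, 0 <= t n) ->
  (t : nat -> R^o) =o_\oo (b : nat -> R^o) ->
  t n / b n @[n --> \oo] --> 0 /\ t n @[n --> \oo] --> 0.
Proof.
move=> cb b0 t0 ot.
have h : t n / b n @[n --> \oo] --> 0.
  apply/cvgr0Pnorm_le => e e0.
  have /eqoP/(_ e e0) := ot => h; near=> n.
  have bn : 0 < b n by apply: b0; near: n; exact: near_pos.
  rewrite normrM normfV ler_pdivrMr ?normr_gt0 ?gt_eqF//; near: n; exact: h.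
split => //.
have : t n / b n * b n @[n --> \oo] --> (0 * 0 : R) by apply: cvgM.
rewrite mulr0; apply: cvg_trans; apply: near_eq_cvg; near=> n.
by rewrite divfK// gt_eqF// b0//; near: n; exact: near_pos.
Unshelve. all: by end_near. Qed.

End gm_asymptotics.

Section gm_sum_limit.
Context {R : realType} {d : nat}.
Notation mu := (@lebesgue_rV R d).
Variables (f sigma2 : 'rV[R]_d -> R) (x : forall n : nat, 'I_n -> 'rV[R]_d).
Variables (b : nat -> R) (B : forall n : nat, 'I_n -> set 'rV[R]_d) (s : nat -> 'rV[R]_d).
Hypothesis f_density : simplex_density f.
Hypothesis f_lip : [lipschitz (f t : R^o) | t in simplex R d].
Hypothesis sigma2_lip : [lipschitz (sigma2 t : R^o) | t in simplex R d].
Variable c : R.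
Hypothesis c_gt0 : 0 < c.
Hypothesis f_ge : forall t, simplex R d t -> c <= f t.
Hypothesis sigma2_ge0 : forall t, simplex R d t -> 0 <= sigma2 t.
Hypothesis b_gt0 : forall n, (0 < n)%N -> 0 < b n.
Hypothesis b_cvg : b n @[n --> \oo] --> 0.
Hypothesis b_rate : (fun n : nat => n%:R `^ (- d%:R^-1) : R^o) =o_\oo (b : nat -> R^o).
Hypothesis partB : gm_partition f x B.
Hypothesis s_int : forall n, (0 < n)%N -> simplex_int R d (s n).
Notation p := (dirichlet_exponent b s).
Hypothesis p_ge1 : \forall n \near \oo, forall k, 1 <= p n k.

Lemma gm_sum_limit : exists2 th : nat -> R, th n @[n --> \oo] --> 0 &
  \forall n \near \oo,
    `|n%:R * (\sum_(i < n) sigma2 (x i) * (\int[mu]_(t in B i) dpdf (p n) t) ^+ 2)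
      - sigma2 (s n) / f (s n) * dpdf2 (p n)| <= th n * dpdf2 (p n).
Proof.
have [Lf Lf0 lf] := lipschitz_coord f_lip.
have [Ls Ls0 ls] := lipschitz_coord sigma2_lip.
have [S hS] := lipschitz_simplex_bounded Ls0 ls.
have [C1 hC1] := gm_diam partB; have [C2 hC2] := gm_mass partB.
pose tau n : R := n%:R `^ (- d%:R^-1).
have tau0 n : 0 <= tau n by exact: powR_ge0.
have [cu ct] := rate_cvg b_cvg b_gt0 tau0 b_rate.
(* This is the parameter [e]: it balances [e] against [b / e] in the deviation bound. *)
pose q n := Num.sqrt (b n).
have cq : q n @[n --> \oo] --> 0.
  rewrite -[X in _ --> X](@sqrtr0 R); apply: (continuous_cvg _ _ b_cvg).
  exact: sqrt_continuous.
(* The constants of the order bounds carry no sign, hence the absolute values. Below, [cA] collects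
   the terms in [tau / b], where the rate n^(-1/d) = o(b) is spent, [cB] those in [tau] and [cC]
   those in [sqrt b]. *)
pose La := (1 + `|C2|) / c.
pose l := Ls / c + S * Lf / c ^+ 2.
pose K : R := (d.+1 * d)%:R * 2 ^+ d.
pose D : R := d.+1%:R.
pose cA := S * La * K * (2 * `|C1|).
pose cB := S * La * K * d%:R * `|C1| + S * (Lf * (d%:R * `|C1|) * La + `|C2|) / c
  + l * d%:R * `|C1|.
pose cC := l * D * (1 + (1 + D ^+ 2)).
exists (fun n => cA * (tau n / b n) + cB * tau n + cC * q n).
  rewrite [X in _ --> X](_ : _ = cA * 0 + cB * 0 + cC * 0); last by rewrite !mulr0 !addr0.
  by apply: cvgD; [apply: cvgD|]; apply: cvgM => //; exact: cvg_cst.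
have iF : mu.-integrable (simplex R d) (EFin \o f).
  have [mf f0 If] := f_density.
  apply/integrableP; split; first exact/measurable_EFinP.
  rewrite (eq_integral (fun t => (f t)%:E)) ?If ?ltry// => t /set_mem St.
  by rewrite /= ger0_norm ?f0.
near=> n.
have n0 : (0 < n)%N by near: n; exact: near_pos.
have N0 : 0 < n%:R :> R by rewrite ltr0n.
have bn := b_gt0 n0.
have q0 : 0 < q n by rewrite sqrtr_gt0.
have t1 : tau n <= 1.
  near: n; move/cvgrPdist_le : ct => /(_ 1 ltr01); apply: filterS => n.
  rewrite sub0r normrN => h; exact: le_trans (ler_norm _) h.
have BS := gm_sub_simplex partB.
apply: le_trans.
  apply: (@gm_sum_estimate R d n (@B n) (@x n) (s n) f sigma2 (b n) Lf Ls S c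
    `|C2| (tau n) (`|C1| * tau n) (q n)) => //.
  - exact: gm_compact partB n.
  - exact: gm_disjoint partB n.
  - exact: gm_cover partB n n0.
  - exact: gm_boundary partB n.
  - by move=> i; apply: interior_subset; exact: (gm_design_point partB).
  - move=> i y z By Bz j; apply: le_trans (coord_le_diam _ (BS _ _) By Bz) _.
    apply: (@le_trans _ _ (C1 * tau n)); last by rewrite ler_wpM2r// ler_norm.
    by move: i {By Bz}; near: n.
  - move=> i; apply: (@le_trans _ _ (C2 * n%:R `^ (- 1 - d%:R^-1))).
      by move: i; near: n.
    rewrite powRD ?(gt_eqF N0) ?implybT// powR_inv1 ?(ltW N0)// mulrCA mulrC -mulrA.
    rewrite mulrA ler_wpM2r ?invr_ge0 ?(ltW N0)//.
    by rewrite ler_wpM2r// ler_norm.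
  - by move=> t St; rewrite sigma2_ge0//= hS.
  - by rewrite tau0.
  - by rewrite mulr_ge0.
  - exact: s_int.
  - by near: n.
rewrite ler_wpM2r ?(ltW (dpdf2_gt0 _))//.
  move=> k; apply: (le_trans ler01); move: k; near: n; exact: p_ge1.
have S0 : 0 <= S.
  by have ss := simplex_int_sub (s_int n0); exact: le_trans (sigma2_ge0 ss) (hS _ ss).
have l0 : 0 <= l by rewrite /l addr_ge0 ?divr_ge0 ?mulr_ge0 ?exprn_ge0 ?(ltW c_gt0).
have hq : (q n)^-1 * ((1 + D ^+ 2) / (2 * (b n)^-1 + D)) <= (1 + D ^+ 2) * q n.
  have D0 : 0 <= D by [].
  have den : 0 < 2 * (b n)^-1 + D by rewrite ltr_wpDr// mulr_gt0 ?invr_gt0.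
  rewrite mulrCA ler_wpM2l ?addr_ge0 ?exprn_ge0//.
  rewrite -invfM -(ler_pM2r (mulr_gt0 q0 den)) mulVf ?gt_eqF ?mulr_gt0// mulrA -expr2.
  rewrite sqr_sqrtr ?(ltW bn)// mulrDr mulrCA divff ?gt_eqF// mulr1.
  by rewrite ler_wpDr ?mulr_ge0 ?(ltW bn)// (_ : 1 = 1%:R)// ler_nat.
rewrite -/La -/l -/K -/D.
apply: (@le_trans _ _ (S * La * (K * ((2 * (b n)^-1 + d%:R) * (`|C1| * tau n))) +
   S * ((Lf * (d%:R * (`|C1| * tau n)) * La + `|C2| * tau n) / c) +
   l * (d%:R * (`|C1| * tau n) + D * (q n + (1 + D ^+ 2) * q n)))).
  rewrite lerD2l ler_wpM2l// lerD2l ler_wpM2l//.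
  by rewrite lerD2l.
rewrite le_eqVlt /cA /cB /cC; apply/orP; left; apply/eqP; field.
by rewrite !gt_eqF.
Unshelve. all: by end_near. Qed.

End gm_sum_limit.

(** The o(1) is a sequence [r] with an exact identity at each positive [n]; [psi], [sigma2] and [f]
    are taken at the moving point [s n]. *)
Theorem proposition4p2 (R : realType) (d : nat) (d_gt0 : (0 < d)%N)
  (f m sigma2 : 'rV[R]_d -> R)
  (x : forall n : nat, 'I_n -> 'rV[R]_d)
  (x_int : forall n (i : 'I_n), simplex_int R d (x n i))
  (f_design : design_density f x)
  (disp : nat -> measure_display)
  (Omega : forall n : nat, measurableType (disp n))
  (P : forall n : nat, probability (Omega n) R)
  (eps : forall n : nat, 'I_n -> {RV (P n) >-> R})
  (eps_indep : forall n, mutually_independent (@eps n))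
  (eps_mean : forall n (i : 'I_n), 'E_(P n)[eps n i]%E = 0%E)
  (eps_var : forall n (i : 'I_n), 'V_(P n)[eps n i]%E = (sigma2 (x n i))%:E)
  (b : nat -> R)
  (b_gt0 : forall n, (0 < n)%N -> 0 < b n)
  (B : forall n : nat, 'I_n -> set 'rV[R]_d)
  (A1_f : [lipschitz (f t : R^o) | t in simplex R d])
  (A1_sigma2 : [lipschitz (sigma2 t : R^o) | t in simplex R d])
  (A1_m : simplex_C2 m)
  (A2_f : exists2 c, is_min_on (simplex R d) f c & 0 < c)
  (A2_sigma2 : exists2 c, is_min_on (simplex R d) sigma2 c & 0 < c)
  (A3_b : b n @[n --> \oo] --> 0)
  (A3_rate : (fun n : nat => n%:R `^ (- d%:R^-1) : R^o) =o_\oo (b : nat -> R^o))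
  (A4 : gm_partition f x B)
  (J : {set 'I_d}) (lambda : 'rV[R]_d)
  (lambda_gt2 : forall j, 2 < lambda 0 j)
  (s : nat -> 'rV[R]_d)
  (s_int : forall n, (0 < n)%N -> simplex_int R d (s n))
  (s_lambda : forall j, j \in J -> s n 0 j / b n @[n --> \oo] --> lambda 0 j)
  (s_fixed : forall j, j \notin J ->
    forall n n', (0 < n)%N -> (0 < n')%N -> s n 0 j = s n' 0 j) :
  exists2 r : nat -> R, r n @[n --> \oo] --> 0 &
    forall n, (0 < n)%N ->
      'V_(P n)[fun w => gm_estimator (b n) (B n)
                          (fun i => m (x n i) + eps n i w)%R (s n)]%E =
      (n%:R^-1 * b n `^ (- ((d + #|J|)%:R / 2)) *
        (psi J (s n) * sigma2 (s n) / f (s n) *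
           \prod_(j in J) (Gamma (2 * lambda 0 j + 1) /
             (2 `^ (2 * lambda 0 j + 1) * Gamma (lambda 0 j + 1) ^+ 2))
         + r n))%:E.
Proof.
have [c _ c0] := A2_f; case: (A2_f) => c1 [_ fc] c10.
have [c2 [_ sc] c20] := A2_sigma2.
have s0 t : simplex R d t -> 0 <= sigma2 t by move=> St; exact: le_trans (ltW c20) (sc _ St).
have l1 j : 1 < lambda 0 j by apply: lt_trans (lambda_gt2 j); rewrite ltr1n.
have [Ls Ls0 ls] := lipschitz_coord A1_sigma2.
have [S hS] := lipschitz_simplex_bounded Ls0 ls.
have p1 := near_exponent_ge1 b_gt0 A3_b s_int l1 s_lambda s_fixed.
have [M hM] := psi_bounded b_gt0 A3_b s_int s_lambda s_fixed.
have [w cw hw] := cvg_dpdf2_rescaled b_gt0 A3_b s_int l1 s_lambda s_fixed.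
have [th cth hth] := gm_sum_limit f_design.1 A1_f A1_sigma2 c10 fc s0 b_gt0 A3_b A3_rate A4 s_int p1.
set G := \prod_(j in J) _ in cw *.
pose q : R := (d + #|J|)%:R / 2.
pose V n := \sum_(i < n) sigma2 (x n i) *
  (\int[lebesgue_rV d]_(t in B n i) dirichlet_kernel (s n) (b n) t) ^+ 2.
(* [r] is what the identity forces it to be, so that only its convergence to 0 carries content. *)
exists (fun n => n%:R * V n * b n `^ q - psi J (s n) * sigma2 (s n) / f (s n) * G); last first.
  move=> n n0.
  transitivity ((V n)%:E); last first.
    congr EFin; have bn := b_gt0 n n0.
    have bq : b n `^ q != 0 by rewrite gt_eqF// powR_gt0.
    rewrite [X in _ * X]addrC subrK powRN -/q; field.
    by rewrite bq pnatr_eq0 -lt0n.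
  exact: variance_indep_sum (eps_indep n) (eps_mean n) (eps_var n).
have VE n : (0 < n)%N -> V n = \sum_(i < n) sigma2 (x n i) *
    (\int[lebesgue_rV d]_(t in B n i) dpdf (dirichlet_exponent b s n) t) ^+ 2.
  move=> n0; apply: eq_bigr => i _; congr (_ * _ ^+ 2).
  apply: eq_Rintegral => t /set_mem Bt.
  by rewrite dirichlet_kernelE//; [exact: s_int|exact: (gm_sub_simplex A4) Bt|exact: b_gt0].
have cbound : (fun n => M * (`|th n * w n| + S / c1 * `|w n - G|)) n @[n --> \oo] --> 0.
  rewrite [X in _ --> X](_ : _ = M * (`|0 * G| + S / c1 * `|G - G|)); last first.
    by rewrite subrr mul0r !normr0 mulr0 addr0 mulr0.
  apply: cvgM; first exact: cvg_cst.
  apply: cvgD; first by apply: cvg_norm; apply: cvgM.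
  apply: cvgM; first exact: cvg_cst.
  by apply: cvg_norm; apply: cvgB => //; exact: cvg_cst.
apply: norm_cvg0; apply: (squeeze_cvgr _ (cvg_cst 0) cbound).
near=> n; rewrite normr_ge0/=.
have n0 : (0 < n)%N by near: n; exact: near_pos.
have /andP[psi0 psiM] : 0 <= psi J (s n) <= M by near: n; exact: hM.
have ss := simplex_int_sub (s_int n n0).
have fs : 0 < f (s n) by exact: lt_le_trans c10 (fc _ ss).
have bq : 0 <= b n `^ q by exact: powR_ge0.
have e : `|n%:R * V n - sigma2 (s n) / f (s n) * dpdf2 (dirichlet_exponent b s n)| <=
    th n * dpdf2 (dirichlet_exponent b s n) by rewrite VE//; near: n.
have hwn := hw n n0.
(* Two errors: that of the Riemann sum, which [dpdf2 * b ^ q = psi * w] turns into at most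
   [psi * th * w], and that of the constant, [w - G], weighted by the bounded [psi * sigma2 / f]. *)
rewrite (_ : _ - _ = (n%:R * V n - sigma2 (s n) / f (s n) * dpdf2 (dirichlet_exponent b s n)) * b n `^ q
  + sigma2 (s n) / f (s n) * psi J (s n) * (w n - G)); last first.
  rewrite mulrBl mulrBr -[_ * dpdf2 _ * _]mulrA hwn; ring.
apply: le_trans (ler_normD _ _) _.
apply: (@le_trans _ _ (psi J (s n) * (`|th n * w n| + S / c1 * `|w n - G|))); last first.
  rewrite ler_wpM2r// addr_ge0// mulr_ge0// divr_ge0 ?(ltW c10)//.
  exact: le_trans (s0 _ ss) (hS _ ss).
rewrite [leRHS]mulrDr; apply: lerD.
  rewrite normrM (ger0_norm bq); apply: le_trans (ler_wpM2r bq e) _.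
  by rewrite -mulrA hwn mulrCA ler_wpM2l// ler_norm.
rewrite 2!normrM (ger0_norm psi0) mulrAC mulrC ler_wpM2l// ler_wpM2r//.
rewrite ger0_norm ?divr_ge0 ?s0 ?(ltW fs)//.
by rewrite ler_pM ?s0 ?invr_ge0 ?(ltW fs) ?hS// lef_pV2 ?posrE// fc.
Unshelve. all: by end_near. Qed.
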